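(* Let $m>1$ be an integer. (Even case.) Let $F_1,\ldots,F_{2m}$ be distinct finite graphs, each with at least one edge, let $e_i$ be the number of edges of $F_i$, and assume $e_1>e_2>\cdots>e_{2m}>0$. Put $\lambda_i=e_i-2m+i$ for $i=1,\ldots,2m$. Then \[\mathrm{Vol}(\mathrm{conv}\, \{ ( p^{e_1}, p^{e_2}, \ldots,p^{e_{2m}} ) \mid 0 \leq p \leq 1 \} ) =\frac{1}{(2m)!\,m!}\int_{[0,1]^m} s_\lambda(x_1,x_1,x_2,x_2,\ldots,x_m,x_m) \prod_{1\le i<j\le m}(x_i-x_j)^4 \, \mathrm{d}x_1\cdots \mathrm{d}x_m .\] (Odd case.) Let $F_1,\ldots,F_{2m+1}$ be distinct finite graphs, each with at least one edge, with edge counts $e_1>e_2>\cdots>e_{2m+1}>0$, and put $\lambda_i=e_i-(2m+1)+i$ for $i=1,\ldots,2m+1$. Then \[\mathrm{Vol}(\mathrm{conv}\, \{ ( p^{e_1}, \ldots,p^{e_{2m+1}} ) \mid 0 \leq p \leq 1 \} )=\frac{1}{(2m+1)!\,m!}\int_{[0,1]^m} s_\lambda(x_1,x_1,\ldots,x_m,x_m,1) \prod_{1\le i<j\le m}(x_i-x_j)^4 \prod_{1\le i\le m}(1-x_i)^2\, \mathrm{d}x_1\cdots \mathrm{d}x_m .\]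
   Context: $\mathrm{Vol}$ denotes Lebesgue measure in the ambient dimension ($2m$ resp. $2m+1$) and $\mathrm{conv}$ the convex hull. For a partition $\lambda=(\lambda_1\ge\cdots\ge\lambda_N\ge 0)$ of length at most $N$, the Schur polynomial is the symmetric polynomial $s_\lambda(z_1,\ldots,z_N)=\det[z_i^{\lambda_j+N-j}]_{i,j=1}^N/\det[z_i^{N-j}]_{i,j=1}^N$; it is a polynomial, so it may be evaluated with repeated arguments. *)

(* Defs.v *)
From HB Require Import structures.
From mathcomp Require Import all_boot all_order all_algebra.
From mathcomp Require Import mpoly.
From mathcomp Require Import all_classical all_reals all_analysis.
From Stdlib Require Import ClassicalEpsilon.

Set Implicit Arguments.
Unset Strict Implicit.
Unset Printing Implicit Defensive.

Import Order.TTheory GRing.Theory Num.Theory.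
Local Open Scope ring_scope.

Record simple_graph := FGraph {
  gV : finType;
  gE : rel gV;
  gE_sym : ssrbool.symmetric gE;
  gE_irr : ssrbool.irreflexive gE }.

Definition nedges (G : simple_graph) : nat :=
  #|[set e : {set gV G} | [exists x, exists y, @gE G x y && (e == [set x; y])]]|.

(* Schur polynomials s_lambda(z_1..z_N) as elements of {mpoly R[N]}:   *)
(* the polynomial s with  s * det[z_i^(N-1-j)] = det[z_i^(lam_j+N-1-j)] *)
(* (indices 0-based; exists and is unique since the Vandermonde        *)
(* determinant is a nonzero element of the integral domain {mpoly R[N]}).*)
Section Schur.
Variables (R : idomainType) (N : nat).

Definition alternant (a : 'I_N -> nat) : {mpoly R[N]} :=
  \det (\matrix_(i < N, j < N) ('X_i ^+ a j : {mpoly R[N]})).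

Definition vandermonde_mpoly : {mpoly R[N]} :=
  alternant (fun j => (N - j.+1)%N).

Definition schur_mpoly (lam : 'I_N -> nat) : {mpoly R[N]} :=
  epsilon (inhabits 0)
    (fun s => s * vandermonde_mpoly = alternant (fun j => (lam j + (N - j.+1))%N)).

(* evaluation s_lambda(z) at a point z, repeated arguments allowed *)
Definition schur (lam : 'I_N -> nat) (z : 'I_N -> R) : R :=
  (schur_mpoly lam).@[z].

End Schur.

Local Open Scope classical_set_scope.

Section Geometry.
Variables (R : realType) (n : nat).

Definition conv_hull (A : set (n.-tuple R)) : set (n.-tuple R) :=
  [set x | exists (k : nat) (w : 'I_k -> R) (pt : 'I_k -> n.-tuple R),
     [/\ (forall i, 0 <= w i), \sum_(i < k) w i = 1, (forall i, A (pt i)) &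
         forall j : 'I_n, tnth x j = \sum_(i < k) w i * tnth (pt i) j]].

Definition box (a b : n.-tuple R) : set (n.-tuple R) :=
  [set x | forall j : 'I_n, tnth a j <= tnth x j <= tnth b j].

Definition box_vol (a b : n.-tuple R) : \bar R :=
  (\prod_(j < n) (tnth b j - tnth a j))%:E.

(* n-dimensional Lebesgue (outer) measure: infimum of the total volume of
   countable covers by boxes; it coincides with Lebesgue measure on
   Lebesgue-measurable sets (e.g. compact convex sets). *)
Definition lebesgue_vol (A : set (n.-tuple R)) : \bar R :=
  ereal_inf [set s | exists (a b : nat -> n.-tuple R),
     [/\ (forall k (j : 'I_n), tnth (a k) j <= tnth (b k) j),
         A `<=` \bigcup_k box (a k) (b k) &
         s = (\sum_(0 <= k <oo) box_vol (a k) (b k))%E]].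

End Geometry.

(* iterated Lebesgue integral over the cube [0,1]^m (for continuous
   integrands it is the m-dimensional integral, by Fubini) *)
Fixpoint cube_integral (R : realType) (m : nat) : (m.-tuple R -> R) -> \bar R :=
  match m return (m.-tuple R -> R) -> \bar R with
  | 0 => fun f => (f [tuple])%:E
  | m'.+1 => fun f =>
      (\int[@lebesgue_measure R]_(x in `[0%R, 1%R]%classic)
          cube_integral (fun t : m'.-tuple R => f [tuple of x :: t]))%E
  end.

Definition moment_pt (R : realType) (n : nat) (e : 'I_n -> nat) (p : R)
  : n.-tuple R := [tuple p ^+ e j | j < n].

Definition curve (R : realType) (n : nat) (e : 'I_n -> nat) : set (n.-tuple R) :=
  [set moment_pt e p | p in `[0%R, 1%R]%classic].

(* Main.v *)
(* Replace the curve by its points at the nodes k/N. Together with the vertex 0 they span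
   a cyclic polytope, triangulated by the simplices on 0, m pairs of consecutive nodes and,
   in odd dimension, the node 1: every point lies in one of them because an optimal
   solution of a linear program has no alternating support, and two open ones are disjoint
   because a generalised polynomial vanishing at the vertices of one of them has constant
   sign at all nodes. Both facts rest on the positivity of generalised Vandermonde
   determinants. Hence the volume of the polytope is a sum of determinants
   det [z_i ^ e_j] / n! with z = (x_1, x_1 + 1/N, x_2, x_2 + 1/N, ...), and each of them is
   N^-m times the value at z of a fixed polynomial, the Schur polynomial times the
   differences across distinct pairs. So the sum is a Riemann sum for the integral, in which
   the two arguments of each pair coincide. *)
Require Import Defs.
From HB Require Import structures.
From mathcomp Require Import all_boot all_order all_algebra.
From mathcomp Require Import fingroup perm mpoly.
From mathcomp Require Import all_classical all_reals all_analysis.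
From mathcomp Require Import measurable_realfun ring lra zify.
Import Order.TTheory GRing.Theory Num.Theory.
Local Open Scope ring_scope.
Set Implicit Arguments.
Unset Strict Implicit.
Unset Printing Implicit Defensive.
Import numFieldNormedType.Exports.
Local Open Scope classical_set_scope.

(** * Lebesgue outer measure and linear maps *)

Section Volume.
Variables (R : realType) (n : nat).
Local Notation T := (n.+1.-tuple R).
Local Notation mu := (@lebesgue_vol R n.+1).
Implicit Types (A B : set T) (a b : nat -> T).

(** [lebesgue_vol] is an outer measure defined by covers with boxes. Covers therefore give upper
    bounds at once, while lower bounds for disjoint pieces need Caratheodory splitting, which is
    proved for coordinate half-spaces and carried to open simplices by invertible linear maps. The
    triangulation is the regular one induced by the height [(-1) ^+ b * p ^+ (e 0).+1], where [b]
    tells odd from even dimension; covering and disjointness both compare values of this height. The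
    new exponent on top and the exponent 0 of the weight condition at the bottom keep every system a
    generalised Vandermonde system. Degenerate choices of pairs, such as overlapping ones, have
    determinant 0 and can stay in the sum. So it may run over all functions from ['I_m] to ['I_N],
    which counts each set of pairs [m!] times: this is the origin of the factor [m!]. In the limit
    the hull of the curve is enclosed in a dilated copy of the polytope. The polytopes used all
    contain one fixed ball, which makes the dilation factor tend to 1. *)

Definition is_box (a b : T) := forall j, tnth a j <= tnth b j.

Lemma box_vol_ge0 (a b : T) : is_box a b -> (0 <= box_vol a b)%E.
Proof.
by move=> ab; rewrite lee_fin prodr_ge0// => j _; rewrite subr_ge0.
Qed.

Lemma lebesgue_vol_le_cover A a b : (forall k, is_box (a k) (b k)) ->
  A `<=` \bigcup_k box (a k) (b k) ->
  (mu A <= \sum_(0 <= k <oo) box_vol (a k) (b k))%E.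
Proof. by move=> ab Aab; apply: ereal_inf_lbound; exists a, b. Qed.

Lemma lebesgue_vol_ge A (c : \bar R) :
  (forall a b, (forall k, is_box (a k) (b k)) ->
     A `<=` \bigcup_k box (a k) (b k) ->
     (c <= \sum_(0 <= k <oo) box_vol (a k) (b k))%E) -> (c <= mu A)%E.
Proof.
by move=> h; apply: le_ereal_inf_tmp => _ [a [b [ab Aab ->]]]; exact: h.
Qed.

Lemma lebesgue_vol_ge0 A : (0 <= mu A)%E.
Proof.
apply: lebesgue_vol_ge => a b ab _; apply: nneseries_ge0 => k _ _.
exact: box_vol_ge0.
Qed.

Lemma le_lebesgue_vol : {homo mu : A B / A `<=` B >-> (A <= B)%E}.
Proof.
move=> A B AB; apply: lebesgue_vol_ge => a b ab Bab.
by apply: lebesgue_vol_le_cover => //; apply: subset_trans Bab.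
Qed.

Lemma box_vol_diag (a : T) : box_vol a a = 0%E.
Proof. by rewrite /box_vol big_ord_recl subrr mul0r. Qed.

Lemma lebesgue_vol_le_box A (a b : T) : is_box a b -> A `<=` box a b ->
  (mu A <= box_vol a b)%E.
Proof.
move=> ab Aab.
pose a' k := if k is 0 then a else [tuple 0 | i < n.+1].
pose b' k := if k is 0 then b else [tuple 0 | i < n.+1].
have /le_trans : (mu A <= \sum_(0 <= k <oo) box_vol (a' k) (b' k))%E.
  apply: lebesgue_vol_le_cover => [[//|k] j|x Ax]; last by exists 0%N => //; exact: Aab.
  by rewrite lexx.
apply; rewrite nneseries_recl//; last first.
  by move=> [|k] _; [exact: box_vol_ge0|rewrite box_vol_diag].
by rewrite eseries0 ?adde0// => -[|k]//= _ _; rewrite box_vol_diag.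
Qed.

Lemma lebesgue_vol0 : mu set0 = 0%E.
Proof.
apply/eqP; rewrite eq_le lebesgue_vol_ge0 andbT.
rewrite -(box_vol_diag [tuple 0 | i < n.+1]).
by apply: lebesgue_vol_le_box => [j|x []]; rewrite lexx.
Qed.

Lemma lebesgue_vol_sigma_subadditive : sigma_subadditive mu.
Proof.
move=> A; have [[i ioo]|] := pselect (exists i, mu (A i) = +oo%E).
  rewrite (eseries_pinfty _ _ ioo) ?leey// => k _.
  by rewrite -ltNye (lt_le_trans _ (lebesgue_vol_ge0 _)).
rewrite -forallNE => Aoo.
suff add2e (e : {posnum R}) :
    (mu (\bigcup_n A n) <= \sum_(i <oo) mu (A i) + e%:num%:E)%E.
  by apply/lee_addgt0Pr => _/posnumP[].
rewrite (le_trans _ (epsilon_trick _ _ _))//; last first.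
  by move=> k; exact: lebesgue_vol_ge0.
pose P k (g : nat -> T * T) := [/\ forall l, is_box (g l).1 (g l).2,
  A k `<=` \bigcup_l box (g l).1 (g l).2 &
  (\sum_(0 <= l <oo) box_vol (g l).1 (g l).2 <=
     mu (A k) + (e%:num / (2 ^ k.+1)%:R)%:E)%E].
have [G PG] : {G : nat -> nat -> T * T & forall k, P k (G k)}.
  apply: (@choice _ _ P) => k; rewrite /P.
  have en1 : 0 < e%:num / (2 ^ k.+1)%:R :> R by [].
  have fin : mu (A k) \is a fin_num.
    by rewrite ge0_fin_numE ?lebesgue_vol_ge0// ltey; apply/eqP/Aoo.
  have [_ [a [b [ab Aab ->]]] lt] := lb_ereal_inf_adherent en1 fin.
  by exists (fun l => (a l, b l)); split => //; exact: ltW.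
pose vol (p : nat * nat) := box_vol (G p.1 p.2).1 (G p.1 p.2).2.
have vol0 p : (0 <= vol p)%E by apply: box_vol_ge0; case: (PG p.1).
apply: (@le_trans _ _ (\esum_(i in setT) vol i)).
  have /card_esym/ppcard_eqP[f] := card_nat2.
  apply: (@le_trans _ _ (\sum_(0 <= k <oo) vol (f k))%E).
    apply: lebesgue_vol_le_cover => [k|t [i _]].
      by case: (PG (f k).1).
    have [_ sub _] := PG i; move=> /sub[j _ ?].
    by exists (f^-1%FUN (i, j)) => //=; rewrite invK ?inE.
  rewrite -(esum_pred_image vol _ xpredT) ?[fun=> _]set_true//.
  by rewrite image_eq.
rewrite (_ : esum _ _ = \sum_(i <oo) \sum_(j <oo) vol (i, j))%E; last first.
  rewrite nneseries_esumT; last by move=> i; exact: nneseries_ge0.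
  under [RHS]eq_esum do rewrite nneseries_esumT//.
  rewrite esum_esum//; congr esum.
  by apply/seteqP; split => -[].
apply: lee_nneseries => k; first by move=> *; exact: nneseries_ge0.
by move=> *; case: (PG k).
Qed.

HB.instance Definition _ := isOuterMeasure.Build R T mu
  lebesgue_vol0 lebesgue_vol_ge0 le_lebesgue_vol lebesgue_vol_sigma_subadditive.

Lemma lebesgue_volU A B : (mu (A `|` B) <= mu A + mu B)%E.
Proof. exact: outer_measureU2. Qed.

Lemma lebesgue_vol_bigU (I : eqType) (s : seq I) (F : I -> set T) :
  (mu [set x | exists2 i, i \in s & F i x] <= \sum_(i <- s) mu (F i))%E.
Proof.
elim: s => [|i s IH].
  rewrite big_nil (_ : [set _ | _] = set0) ?lebesgue_vol0//.
  by apply/seteqP; split => // x [].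
rewrite big_cons; apply: le_trans (leeD2l _ IH).
apply: le_trans (lebesgue_volU _ _); apply: le_lebesgue_vol => x [j].
rewrite inE => /orP[/eqP-> Fx|js Fx]; [by left|by right; exists j].
Qed.

(* Caratheodory measurability; the other inequality is subadditivity. *)
Definition splits (E : set T) := forall X, (mu (X `&` E) + mu (X `\` E) <= mu X)%E.

Lemma splits_setI E F : splits E -> splits F -> splits (E `&` F).
Proof.
move=> sE sF X; apply: le_trans (sE X).
apply: (@le_trans _ _ (mu (X `&` E `&` F) + (mu ((X `&` E) `\` F) + mu (X `\` E)))%E).
  rewrite setIA leeD2l//; apply: le_trans (lebesgue_volU _ _).
  apply: le_lebesgue_vol => x [Xx nEF].
  have [Ex|nEx] := pselect (E x); [left|by right].
  by split => // Fx; apply: nEF.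
by rewrite addeA leeD2r.
Qed.

Lemma splits_bigI (I : eqType) (s : seq I) (F : I -> set T) :
  (forall i, splits (F i)) -> splits [set x | forall i, i \in s -> F i x].
Proof.
move=> sF; elim: s => [|i s IH].
  move=> X; rewrite (_ : [set _ | _] = setT).
    by rewrite setIT setDT lebesgue_vol0 adde0.
  by apply/seteqP; split.
rewrite (_ : [set _ | _] = F i `&` [set x | forall j, j \in s -> F j x]).
  exact: splits_setI.
apply/seteqP; split => [x h|x [Fx h] j].
  by split; [apply: h|move=> j js; apply: h]; rewrite inE ?eqxx// js orbT.
by rewrite inE => /orP[/eqP->//|/h].
Qed.

(** Splitting the union along the first piece leaves the other pieces untouched. This
    superadditivity is the source of the lower bounds for volumes of disjoint unions. *)
Lemma splits_disjoint (I : eqType) (s : seq I) (F : I -> set T) : uniq s ->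
  (forall i, splits (F i)) ->
  (forall i j x, i \in s -> j \in s -> F i x -> F j x -> i = j) ->
  (\sum_(i <- s) mu (F i) <= mu [set x | exists2 i, i \in s & F i x])%E.
Proof.
move=> + sF; elim: s => [|i s IH] /=; first by rewrite big_nil lebesgue_vol_ge0.
case/andP => is_ us dF; rewrite big_cons.
apply: le_trans (sF i _); apply: leeD.
  apply: le_lebesgue_vol => x Fx; split => //.
  by exists i => //; rewrite inE eqxx.
apply: le_trans (IH us _) _.
  by move=> j k x js ks; apply: dF; rewrite inE ?js ?ks orbT.
apply: le_lebesgue_vol => x [j js Fx]; split; first by exists j => //; rewrite inE js orbT.
move=> Fix; move: is_; rewrite (dF i j x) ?js// inE ?eqxx//.
by rewrite js orbT.
Qed.

End Volume.

(** * Lower bound for the volume of the unit cube *)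

Section Boxes.
Variable R : realType.

(* Induction on [n]: integrate the inequality over the first coordinate. *)
Lemma box_weight_ge1 n (c : nat -> R) (a b : nat -> n.-tuple R) :
  (forall k, 0 <= c k) -> (forall k j, tnth (a k) j <= tnth (b k) j) ->
  (forall x : n.-tuple R, (forall j, 0 <= tnth x j <= 1) ->
     (1 <= \sum_(0 <= k <oo) (c k * (x \in box (a k) (b k))%:R)%:E)%E) ->
  (1 <= \sum_(0 <= k <oo) ((c k)%:E * box_vol (a k) (b k)))%E.
Proof.
elim: n c a b => [|n IH] c a b c0 ab cov.
  have := cov [tuple] (fun j => match j with Ordinal m i => ltac:(done) end).
  move/le_trans; apply; apply: lee_nneseries => [k _ _|k _].
    by rewrite lee_fin mulr_ge0.
  by rewrite /box_vol big_ord0 mule1 lee_fin ler_piMr// lern1 leq_b1.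
pose I k := `[tnth (a k) ord0, tnth (b k) ord0]%classic : set R.
pose tl (x : n.+1.-tuple R) : n.-tuple R := [tuple tnth x (lift ord0 j) | j < n].
pose v k := \prod_(j < n) (tnth (tl (b k)) j - tnth (tl (a k)) j).
have v0 k : 0 <= v k.
  by apply: prodr_ge0 => j _; rewrite !tnth_mktuple subr_ge0.
have h (t : R) : `[0%R, 1%R]%classic t ->
    (1 <= \sum_(0 <= k <oo) (c k * v k * \1_(I k) t)%:E)%E.
  rewrite /= in_itv/= => t01.
  (* The weights serve this step: a box that misses the slice at [t] gets weight 0. *)
  have := IH (fun k => c k * \1_(I k) t) (tl \o a) (tl \o b).
  rewrite (_ : (\sum_(0 <= k <oo) _)%E =
               (\sum_(0 <= k <oo) (c k * v k * \1_(I k) t)%:E)%E); last first.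
    by apply: eq_eseriesr => k _; rewrite /box_vol -EFinM -/(v k) mulrAC.
  apply => [k|k j|y y01].
  - by rewrite mulr_ge0// indicE.
  - by rewrite !tnth_mktuple.
  apply: le_trans (cov [tuple of t :: y] _) _.
    move=> j; have [->|[j' ->]] : j = ord0 \/ exists j', j = lift ord0 j'.
    + by case: (unliftP ord0 j) => [j' ->|->]; [right; exists j'|left].
    + by rewrite tnth0.
    + by rewrite tnthS.
  apply: lee_nneseries => [k _ _|k _]; first by rewrite lee_fin mulr_ge0.
  rewrite lee_fin -mulrA ler_wpM2l// indicE.
  case: (boolP (_ \in box (a k) _)) => [/set_mem xb|_]; last by rewrite mulr_ge0.
  rewrite !mem_set ?mulr1//; last by have := xb ord0; rewrite tnth0 /I /= in_itv.
  by move=> j; have := xb (lift ord0 j); rewrite tnthS !tnth_mktuple.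
pose f k : R -> \bar R := fun t => (c k * v k * \1_(I k) t)%:E.
have mf k : measurable_fun (`[0%R, 1%R]%classic : set R) (f k).
  apply/measurable_EFinP; apply: measurable_funM; first exact: measurable_cst.
  by apply: measurable_indic; exact: measurable_itv.
have mI k : measurable (I k) by exact: measurable_itv.
have f0 k (t : R) : (0 <= f k t)%E.
  by rewrite lee_fin mulr_ge0// mulr_ge0.
apply: (@le_trans _ _ (\int[@lebesgue_measure R]_(t in `[0%R, 1%R]%classic)
    \sum_(0 <= k <oo) f k t)%E).
  have -> : 1%E = (\int[@lebesgue_measure R]_(t in `[0%R, 1%R]%classic) 1%E)%E.
    by rewrite integral_cst// mul1e/= lebesgue_measure_itv/= lte01 oppr0 adde0.
  apply: ge0_le_integral => //.
  by apply: (@ge0_emeasurable_sum _ _ _ _ f xpredT) => // *; exact: mf.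
rewrite integral_nneseries//; apply: lee_nneseries => [k _ _|k _].
  exact: integral_ge0.
under eq_integral do rewrite /f EFinM.
rewrite ge0_integralZl_EFin//; last 2 first.
- by apply/measurable_EFinP; apply: measurable_indic; exact: measurable_itv.
- by rewrite mulr_ge0.
rewrite integral_indic//; last exact: measurable_itv.
rewrite /box_vol -EFinM big_ord_recl.
apply: (@le_trans _ _ ((c k * v k)%:E * lebesgue_measure (I k)))%E.
  rewrite lee_wpmul2l ?lee_fin ?mulr_ge0// le_measure// ?inE//.
  by apply: measurableI; exact: measurable_itv.
  exact: measurable_itv.
have -> : lebesgue_measure (I k) = (tnth (b k) ord0 - tnth (a k) ord0)%:E.
  rewrite /I /= lebesgue_measure_itv/= lte_fin.
  by have := ab k ord0; case: ltgtP => // -> _; rewrite subrr.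
rewrite -EFinM lee_fin -mulrA ler_wpM2l// mulrC ler_wpM2l ?subr_ge0//.
by rewrite /v; under eq_bigr do rewrite !tnth_mktuple.
Qed.

Lemma lebesgue_vol_cube n :
  (1 <= lebesgue_vol [set x : n.+1.-tuple R | forall j, (0 <= tnth x j <= 1)%R])%E.
Proof.
apply: lebesgue_vol_ge => a b ab cov.
under eq_eseriesr do rewrite -[box_vol _ _]mul1e.
apply: (@box_weight_ge1 _ (fun=> 1)) => // x /cov[k _ xk].
apply: (@le_trans _ _ (\sum_(k <= i < k.+1)
    (1 * (x \in box (a i) (b i))%:R)%:E)%E).
  by rewrite big_nat1 mem_set// mulr1.
have f0 i : (0 <= (1 * (x \in box (a i) (b i))%:R : R)%:E)%E.
  by rewrite lee_fin mulr_ge0.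
apply: (@le_trans _ _ (\sum_(0 <= i < k.+1)
    (1 * (x \in box (a i) (b i))%:R)%:E)%E).
  by rewrite [leRHS](big_cat_nat _ (n := k))//= leeDr// sume_ge0.
exact: nneseries_lim_ge.
Qed.

End Boxes.

(** * Linear maps multiply volume by the determinant *)

Section LinearImages.
Variable R : realType.

Definition lin n (L : 'M[R]_n) (x : n.-tuple R) : n.-tuple R :=
  [tuple \sum_k L j k * tnth x k | j < n].

Lemma lin_mul n (A B : 'M[R]_n) x : lin (A *m B) x = lin A (lin B x).
Proof.
apply: eq_from_tnth => j; rewrite !tnth_mktuple.
under [RHS]eq_bigr do rewrite tnth_mktuple mulr_sumr.
rewrite exchange_big; apply: eq_bigr => k _ /=.
by rewrite mxE mulr_suml; apply: eq_bigr => l _; rewrite mulrA.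
Qed.

Lemma lin1 n (x : n.-tuple R) : lin 1%:M x = x.
Proof.
apply: eq_from_tnth => j; rewrite !tnth_mktuple (bigD1 j)//= mxE eqxx mul1r.
by rewrite big1 ?addr0// => k kj; rewrite mxE eq_sym (negPf kj) mul0r.
Qed.

Variable n : nat.
Local Notation T := (n.+1.-tuple R).
Local Notation mu := (@lebesgue_vol R n.+1).
Implicit Types (A B X : set T) (L M : 'M[R]_n.+1).

Lemma cube_exhaustion (x : T) :
  exists k : nat, box [tuple - k%:R | j < n.+1] [tuple k%:R | j < n.+1] x.
Proof.
exists (Num.Def.archi_bound (\sum_j `|tnth x j|)) => j.
rewrite !tnth_mktuple -ler_norml; apply: ltW.
apply: le_lt_trans (archi_boundP _); last by apply: sumr_ge0.
by rewrite (bigD1 j)//= lerDl sumr_ge0.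
Qed.

Lemma le_image_vol (f : T -> T) (c : R) : 0 <= c ->
  (forall a b, is_box a b -> (mu (f @` box a b) <= c%:E * box_vol a b)%E) ->
  forall A, (mu (f @` A) <= c%:E * mu A)%E.
Proof.
move=> c0 fc A.
have cov a b : (forall k, is_box (a k) (b k)) -> A `<=` \bigcup_k box (a k) (b k) ->
    (mu (f @` A) <= c%:E * \sum_(0 <= k <oo) box_vol (a k) (b k))%E.
  move=> ab Aab; rewrite -nneseriesZl; last by move=> *; exact: box_vol_ge0.
  apply: (@le_trans _ _ (mu (\bigcup_k (f @` box (a k) (b k))))).
    by apply: le_lebesgue_vol => _ [x /Aab[k _ xk] <-]; exists k => //; exists x.
  apply: le_trans (lebesgue_vol_sigma_subadditive _) _.
  apply: lee_nneseries => k *; [exact: lebesgue_vol_ge0|exact: fc].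
(* For [c = 0] division is impossible, and [A] may have infinite measure; but the images of the
   boxes of a countable cover of the whole space are then null. *)
move: c0; rewrite le_eqVlt => /predU1P[c0|c0].
  rewrite -c0 mul0e.
  apply: (le_trans (cov (fun k => [tuple - k%:R | j < n.+1])
    (fun k => [tuple k%:R | j < n.+1]) _ _)).
  - by move=> k j; rewrite !tnth_mktuple (@le_trans _ _ 0)// oppr_le0.
  - by move=> x _; have [k xk] := cube_exhaustion x; exists k.
  - by rewrite -c0 mul0e.
rewrite -lee_pdivrMl//; apply: lebesgue_vol_ge => a b ab Aab.
by rewrite lee_pdivrMl//; exact: cov.
Qed.

Definition translate (v x : T) : T := [tuple tnth v j + tnth x j | j < n.+1].

Lemma le_translate_vol (v : T) A : (mu (translate v @` A) <= mu A)%E.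
Proof.
rewrite -[leRHS]mul1e; apply: le_image_vol => // a b ab; rewrite mul1e.
apply: (@le_trans _ _ (box_vol [tuple tnth v j + tnth a j | j < n.+1]
                               [tuple tnth v j + tnth b j | j < n.+1])).
  apply: lebesgue_vol_le_box => [j|_ [x xab <-] j].
    by rewrite !tnth_mktuple lerD2l.
  by rewrite !tnth_mktuple !lerD2l.
rewrite lee_fin le_eqVlt; apply/orP; left; apply/eqP; apply: eq_bigr => j _.
by rewrite !tnth_mktuple; ring.
Qed.

Lemma lin_perm (s : 'S_n.+1) (x : T) : lin (perm_mx s) x = [tuple tnth x (s j) | j < n.+1].
Proof.
apply: eq_from_tnth => j; rewrite !tnth_mktuple (bigD1 (s j))//= !mxE eqxx mul1r.
by rewrite big1 ?addr0// => k kj; rewrite !mxE eq_sym (negPf kj) mul0r.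
Qed.

(** One inequality suffices: it is stable under products, and for invertible [L] the reverse one
    follows by applying it to the inverse. *)
Definition contracting L := forall A, (mu (lin L @` A) <= `|\det L|%:E * mu A)%E.

Lemma contracting_mul L M : contracting L -> contracting M -> contracting (L *m M).
Proof.
move=> cL cM A; rewrite det_mulmx normrM EFinM -muleA.
apply: (@le_trans _ _ (mu (lin L @` (lin M @` A)))).
  apply: le_lebesgue_vol => _ [x Ax <-]; exists (lin M x); first by exists x.
  by rewrite lin_mul.
by apply: le_trans (cL _) _; rewrite lee_wpmul2l// lee_fin.
Qed.

Lemma contracting_perm s : contracting (perm_mx s).
Proof.
apply: le_image_vol => // a b ab; rewrite det_perm normrX normrN1 expr1n mul1e.
apply: (@le_trans _ _ (box_vol [tuple tnth a (s j) | j < n.+1]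
                               [tuple tnth b (s j) | j < n.+1])).
  apply: lebesgue_vol_le_box => [j|_ [x xab <-] j].
    by rewrite !tnth_mktuple.
  by rewrite lin_perm !tnth_mktuple.
rewrite lee_fin le_eqVlt; apply/orP; left; apply/eqP.
rewrite [RHS](reindex_inj (@perm_inj _ s)).
by apply: eq_bigr => j _; rewrite !tnth_mktuple.
Qed.

Definition col_mx1 (k : 'I_n.+1) (u : 'I_n.+1 -> R) : 'M[R]_n.+1 :=
  \matrix_(i, j) if j == k then u i else (i == j)%:R.

Lemma det_col_mx1 k u : \det (col_mx1 k u) = u k.
Proof.
rewrite (expand_det_row _ k) (bigD1 k)//= big1 ?addr0; last first.
  by move=> j jk; rewrite mxE (negPf jk) eq_sym (negPf jk) mul0r.
rewrite mxE eqxx /cofactor addnn -signr_odd odd_double mul1r.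
rewrite (_ : row' _ _ = 1%:M) ?det1 ?mulr1//.
by apply/matrixP => i j; rewrite !mxE eq_sym (negPf (neq_lift _ _)) (inj_eq lift_inj).
Qed.

Lemma lin_col_mx1 k u (x : T) j : tnth (lin (col_mx1 k u) x) j =
  if j == k then u k * tnth x k else tnth x j + u j * tnth x k.
Proof.
rewrite tnth_mktuple (bigD1 k)//= mxE eqxx.
have [->|jk] := eqVneq j k.
  rewrite big1 ?addr0// => l lk; rewrite mxE (negPf lk) eq_sym (negPf lk).
  by rewrite mul0r.
rewrite (bigD1 j)//= mxE (negPf jk) eqxx mul1r big1; first by rewrite addr0 addrC.
by move=> l /andP[lk lj]; rewrite mxE (negPf lk) eq_sym (negPf lj) mul0r.
Qed.

Lemma mul_between (u s t x : R) : s <= x <= t ->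
  Num.min (u * s) (u * t) <= u * x <= Num.max (u * s) (u * t).
Proof.
move=> /andP[sx xt]; have [u0|/ltW u0] := leP 0 u.
  by rewrite ge_min le_max (ler_wpM2l u0 sx) (ler_wpM2l u0 xt) orbT.
by rewrite ge_min le_max (ler_wnM2l u0 sx) (ler_wnM2l u0 xt) !orbT.
Qed.

Lemma max_sub_min (x y : R) : Num.max x y - Num.min x y = `|x - y|.
Proof. by rewrite maxr_absE minr_absE; field. Qed.

Lemma subdivision_cell (s : nat -> R) N y : s 0%N <= y <= s N.+1 ->
  exists2 t, (t < N.+1)%N & s t <= y <= s t.+1.
Proof.
elim: N => [|N IH] /andP[s0 sN]; first by exists 0%N; rewrite ?s0.
have [yN|/ltW Ny] := leP y (s N.+1); last by exists N.+1; rewrite ?Ny.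
by have [|t tN st] := IH _; [rewrite s0|exists t => //; exact: ltnW].
Qed.

(* Cut the box into thin slabs along the [k]-th axis: the image of each slab
   lies in a box that is only slightly wider than the slab. *)
Lemma vol_col_slabs k u a b (N : nat) : is_box a b ->
  (mu (lin (col_mx1 k u) @` box a b) <=
   (`|u k| * (tnth b k - tnth a k) * \prod_(j | j != k)
     (tnth b j - tnth a j + `|u j| * ((tnth b k - tnth a k) / N.+1%:R)))%:E)%E.
Proof.
move=> ab; set d := (_ - _) / _.
have d0 : 0 <= d by rewrite divr_ge0// subr_ge0.
pose s (t : nat) := tnth a k + t%:R * d.
pose lo t j := Num.min (u j * s t) (u j * s t.+1).
pose hi t j := Num.max (u j * s t) (u j * s t.+1).
have lohi t j : lo t j <= hi t j by rewrite ge_min !le_max lexx.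
pose a' t : T := [tuple if j == k then lo t k else tnth a j + lo t j | j < n.+1].
pose b' t : T := [tuple if j == k then hi t k else tnth b j + hi t j | j < n.+1].
have ab' t : is_box (a' t) (b' t).
  move=> j; rewrite !tnth_mktuple; case: ifP => _ //; exact: lerD.
have len t j : hi t j - lo t j = `|u j| * d.
  rewrite max_sub_min -mulrBr normrM distrC; congr (_ * _).
  by rewrite /s opprD addrACA subrr add0r -mulrBl -natrB// subSnn mul1r ger0_norm.
have vol t : box_vol (a' t) (b' t) =
    (`|u k| * d * \prod_(j | j != k) (tnth b j - tnth a j + `|u j| * d))%:E.
  rewrite /box_vol (bigD1 k)//= !tnth_mktuple eqxx len; congr (_ * _)%:E.
  apply: eq_bigr => j /negPf jk; rewrite !tnth_mktuple jk opprD addrACA.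
  by rewrite len.
have Nd : N.+1%:R * d = tnth b k - tnth a k by rewrite mulrC mulfVK.
apply: (@le_trans _ _ (\sum_(t <- iota 0 N.+1) mu (box (a' t) (b' t)))%E).
  apply: le_trans (lebesgue_vol_bigU _ _).
  apply: le_lebesgue_vol => _ [x xab <-].
  suff [t tN /andP[st st1]] : exists2 t, (t < N.+1)%N & s t <= tnth x k <= s t.+1.
    exists t; first by rewrite mem_iota.
    move=> j; rewrite lin_col_mx1 !tnth_mktuple.
    have /andP[h1 h2] : lo t j <= u j * tnth x k <= hi t j.
      by apply: mul_between; rewrite st.
    case: ifPn => [/eqP jk|_]; first by subst j; rewrite h1.
    by have /andP[h3 h4] := xab j; rewrite !lerD.
  apply: subdivision_cell.
  by rewrite /s Nd mul0r addr0 addrC subrK; exact: xab.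
rewrite (@le_trans _ _ (\sum_(t <- iota 0 N.+1) (`|u k| * d *
    \prod_(j | j != k) (tnth b j - tnth a j + `|u j| * d))%:E)%E)//.
  by apply: lee_sum => t _; rewrite -(vol t); exact: lebesgue_vol_le_box.
rewrite sumEFin lee_fin big_const_seq iter_addr_0 count_predT size_iota.
by rewrite -mulr_natl -Nd le_eqVlt; apply/orP; left; apply/eqP; ring.
Qed.

(** As the number of slabs grows, the widening of the boxes that contain their images vanishes. *)
Lemma contracting_col k u : contracting (col_mx1 k u).
Proof.
apply: le_image_vol => // a b ab; rewrite det_col_mx1.
set D := tnth b k - tnth a k.
pose p (N : nat) := `|u k| * D * \prod_(j | j != k)
  (tnth b j - tnth a j + `|u j| * (D / N.+1%:R)).
have cvp : p @ \oo --> `|u k| * D * \prod_(j | j != k) (tnth b j - tnth a j + `|u j| * (D * 0)).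
  apply: cvgM; first exact: cvg_cst.
  apply: cvg_big => [|j _]; first exact: mul_continuous.
  apply: cvgD; first exact: cvg_cst.
  apply: cvgM; first exact: cvg_cst.
  by apply: cvgM; [exact: cvg_cst|exact: cvg_harmonic].
have fin : mu (lin (col_mx1 k u) @` box a b) \is a fin_num.
  rewrite ge0_fin_numE ?lebesgue_vol_ge0//.
  exact: le_lt_trans (vol_col_slabs k u 0 ab) (ltry _).
rewrite -(fineK fin) /box_vol -EFinM lee_fin (bigD1 k)//= mulrA.
rewrite (eq_bigr (fun j => tnth b j - tnth a j + `|u j| * (D * 0))); last first.
  by move=> j _; rewrite !mulr0 addr0.
apply: cvgr_to_ge cvp _; apply: nearW => N.
by rewrite -lee_fin fineK//; exact: vol_col_slabs.
Qed.

(* Such a matrix is a product of matrices [col_mx1], taken in the order [r]. *)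
Lemma contracting_triangular (r : 'I_n.+1 -> nat) (U : 'M[R]_n.+1) :
  injective r -> (forall i j, U i j != 0 -> (r i <= r j)%N) -> contracting U.
Proof.
move=> rI rU.
pose M t : 'M[R]_n.+1 := \matrix_(i, j) if (r j < t)%N then U i j else (i == j)%:R.
have cM t : contracting (M t).
  elim: t => [|t IH].
    rewrite (_ : M 0%N = perm_mx 1); first exact: contracting_perm.
    by rewrite perm_mx1; apply/matrixP => i j; rewrite !mxE.
  have [[k rk]|nk] := pselect (exists k, r k = t); last first.
    rewrite (_ : M t.+1 = M t)//; apply/matrixP => i j; rewrite !mxE ltnS leq_eqVlt.
    by case: eqP => //= rj; case: nk; exists j.
  (* The columns inserted so far have a zero in row [k], so the left factor leaves them unchanged
     and only turns the unit column [k] into that of [U]. *)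
  rewrite (_ : M t.+1 = col_mx1 k (fun i => U i k) *m M t).
    exact: contracting_mul (contracting_col _ _) IH.
  apply/matrixP => i j; rewrite [RHS]mxE (bigD1 k)//= !mxE eqxx ltnS.
  have -> : \sum_(l | l != k) col_mx1 k (U^~ k) i l * M t l j =
      if i == k then 0 else M t i j.
    have [->|ik] := eqVneq i k.
      by rewrite big1// => l lk; rewrite mxE (negPf lk) eq_sym (negPf lk) mul0r.
    rewrite (bigD1 i)//= big1 ?addr0; last first.
      by move=> l /andP[lk li]; rewrite mxE (negPf lk) eq_sym (negPf li) mul0r.
    by rewrite [col_mx1 _ _ _ _]mxE (negPf ik) eqxx mul1r.
  have Ukj : (r j < t)%N -> U k j = 0.
    move=> jt; apply/eqP; apply: contraTT jt => /rU; rewrite rk -leqNgt; exact.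
  have [rjt|rjt|rjt] := ssrnat.ltngtP (r j) t.
  - rewrite (Ukj rjt) mulr0 add0r; case: (eqVneq i k) => [->|_]; first exact: Ukj.
    by rewrite mxE rjt.
  - have jk : k != j by apply/eqP => jk; move: rjt; rewrite -jk rk ltnn.
    rewrite (negPf jk) mulr0 add0r; case: (eqVneq i k) => [->|ik]; first by rewrite (negPf jk).
    by rewrite mxE ltnNge (ltnW rjt).
  - have jk : j = k by apply: rI; rewrite rk.
    rewrite jk eqxx mulr1; case: (eqVneq i k) => [->|ik]; first by rewrite addr0.
    by rewrite mxE rk ltnn (negPf ik) addr0.
rewrite (_ : U = M (\max_i r i).+1)//; apply/matrixP => i j.
by rewrite mxE ltnS leq_bigmax.
Qed.

(** The LUP decomposition leaves permutation and triangular matrices. It also exists for singular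
    [L], so flat images are seen to be null. *)
Theorem le_lin_vol L A : (mu (lin L @` A) <= `|\det L|%:E * mu A)%E.
Proof.
move: A; rewrite -/(contracting L).
have := @cormen_lup_perm R n L; have := @cormen_lup_correct R n L.
have := @cormen_lup_lower R n L; have := @cormen_lup_upper R n L.
case: (cormen_lup L) => [[P B] U] /= Uup Blow PBU /is_perm_mxP[s Ps].
have -> : L = perm_mx s^-1 *m (B *m U).
  by rewrite -[B *m U]PBU Ps [perm_mx s * L]/(perm_mx s *m L) mulmxA -perm_mxM mulVg perm_mx1 mul1mx.
apply: contracting_mul; first exact: contracting_perm.
apply: contracting_mul.
  (* Reversing the order of the indices makes the lower triangular factor upper triangular. *)
  apply: (@contracting_triangular (fun i => n - i)%N).
    move=> i j /eqP ij; apply/val_inj => /=; have := ltn_ord i; have := ltn_ord j; lia.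
  move=> i j Bij; apply: leq_sub2l; rewrite leqNgt; apply/negP => ij.
  by move: Bij; rewrite Blow ?(ltnW ij)// -val_eqE/= (ltn_eqF ij) eqxx.
apply: (@contracting_triangular val) => [|i j]; first exact: val_inj.
by apply: contraNT; rewrite -ltnNge => /Uup ->.
Qed.

Lemma lin_vol L A : L \in unitmx -> mu (lin L @` A) = (`|\det L|%:E * mu A)%E.
Proof.
move=> uL; apply/eqP; rewrite eq_le le_lin_vol/=.
have dL : 0 < `|\det L| by rewrite normr_gt0 -unitfE -unitmxE.
rewrite -lee_pdivlMl// -normfV -det_inv.
apply: le_trans (le_lin_vol _ _); apply: le_lebesgue_vol => x Ax.
by exists (lin L x); [exists x|rewrite -lin_mul mulVmx// lin1].
Qed.

Lemma translate_vol v A : mu (translate v @` A) = mu A.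
Proof.
apply/eqP; rewrite eq_le le_translate_vol/=.
apply: le_trans (le_translate_vol [tuple - tnth v j | j < n.+1] _).
apply: le_lebesgue_vol => x Ax; exists (translate v x); first by exists x.
by apply: eq_from_tnth => j; rewrite !tnth_mktuple addKr.
Qed.

Lemma splits_preimage_lin L E : L \in unitmx -> splits E -> splits (lin L @^-1` E).
Proof.
move=> uL sE X.
have pre Y : mu Y = (`|\det (invmx L)|%:E * mu (lin L @` Y))%E.
  rewrite -lin_vol ?unitmx_inv//; congr (mu _); apply/seteqP; split => [x Yx|].
    by exists (lin L x); [exists x|rewrite -lin_mul mulVmx// lin1].
  by move=> _ [_ [x Yx <-] <-]; rewrite -lin_mul mulVmx// lin1.
rewrite (pre (X `\` _)) (pre (X `&` _)) (pre X) -ge0_muleDr ?lebesgue_vol_ge0//.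
rewrite lee_wpmul2l ?lee_fin//; apply: le_trans (sE _); apply: leeD.
  by apply: le_lebesgue_vol => _ [x [Xx Ex] <-]; split => //; exists x.
by apply: le_lebesgue_vol => _ [x [Xx Ex] <-]; split => //; exists x.
Qed.

Lemma splits_halfspace_lt (j : 'I_n.+1) (c : R) : splits [set x : T | tnth x j < c].
Proof.
move=> X; apply: lebesgue_vol_ge => a b ab Xab.
(* The cut is clamped to the side of the box, so that both parts are boxes, one of them possibly
   flat. *)
pose cl k := Num.max (tnth (a k) j) (Num.min (tnth (b k) j) c).
have acl k : tnth (a k) j <= cl k by rewrite le_max lexx.
have clb k : cl k <= tnth (b k) j by rewrite ge_max ge_min lexx ab.
pose a' k : T := [tuple if i == j then cl k else tnth (a k) i | i < n.+1].
pose b' k : T := [tuple if i == j then cl k else tnth (b k) i | i < n.+1].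
have ab' k : is_box (a k) (b' k).
  by move=> i; rewrite tnth_mktuple; case: eqP => [->|_] //; exact: ab.
have a'b k : is_box (a' k) (b k).
  by move=> i; rewrite tnth_mktuple; case: eqP => [->|_] //; exact: ab.
have -> : (\sum_(0 <= k <oo) box_vol (a k) (b k) =
    \sum_(0 <= k <oo) box_vol (a k) (b' k) + \sum_(0 <= k <oo) box_vol (a' k) (b k))%E.
  rewrite -nneseriesD; [|by move=> k *; exact: box_vol_ge0..].
  have D1 (u v : T) : \prod_i (tnth v i - tnth u i) = (tnth v j - tnth u j) *
      \prod_(i | i != j) (tnth v i - tnth u i) by rewrite (bigD1 j).
  apply: eq_eseriesr => k _; rewrite /box_vol -EFinD !D1.
  have -> : \prod_(i | i != j) (tnth (b' k) i - tnth (a k) i) =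
      \prod_(i | i != j) (tnth (b k) i - tnth (a k) i).
    by apply: eq_bigr => i /negPf ij; rewrite tnth_mktuple ij.
  have -> : \prod_(i | i != j) (tnth (b k) i - tnth (a' k) i) =
      \prod_(i | i != j) (tnth (b k) i - tnth (a k) i).
    by apply: eq_bigr => i /negPf ij; rewrite tnth_mktuple ij.
  rewrite !tnth_mktuple eqxx.
  by congr (_%:E); ring.
apply: leeD; apply: lebesgue_vol_le_cover => // x [Xx]/= xc.
  have [k _ xk] := Xab _ Xx; exists k => // i; rewrite tnth_mktuple.
  have /andP[xa xb] := xk i; rewrite xa/=; case: eqP => // ij; subst i.
  by rewrite le_max le_min xb (ltW xc) orbT.
have [k _ xk] := Xab _ Xx; exists k => // i; rewrite tnth_mktuple.
have /andP[xa xb] := xk i; rewrite xb andbT; case: eqP => // ij; subst i.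
by rewrite ge_max xa ge_min; move/negP : xc; rewrite -leNgt => ->; rewrite orbT.
Qed.

Lemma splits_halfspace_gt (j : 'I_n.+1) (c : R) : splits [set x : T | c < tnth x j].
Proof.
have uL : (-1)%:M \in @unitmx R n.+1 by rewrite unitmxE det_scalar unitrX// unitrN1.
have := splits_preimage_lin uL (splits_halfspace_lt j (- c)).
congr splits; apply/seteqP.
have e x : tnth (lin (-1)%:M x) j = - tnth x j.
  rewrite tnth_mktuple (bigD1 j)//= mxE eqxx mulr1n mulN1r big1 ?addr0// => k kj.
  by rewrite mxE eq_sym (negPf kj) mul0r.
by split => x /=; rewrite e ltrN2.
Qed.

End LinearImages.

(** * Volume of the standard simplex *)

Section Simplex.
Variables (R : realType) (n : nat).
Local Notation T := (n.+1.-tuple R).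
Local Notation mu := (@lebesgue_vol R n.+1).

Definition simplex : set T := [set x | (forall j, 0 <= tnth x j) /\ \sum_j tnth x j <= 1].
Definition osimplex : set T := [set x | (forall j, 0 < tnth x j) /\ \sum_j tnth x j < 1].

(** Maps the standard simplex onto the weakly decreasing points of the unit cube; the images under
    coordinate permutations fill the cube. *)
Definition cumul : 'M[R]_n.+1 := \matrix_(j, k) (j <= k)%:R.

Lemma det_cumul : \det cumul = 1.
Proof.
rewrite -det_tr det_trig; first by rewrite big1// => i _; rewrite !mxE leqnn.
by apply/is_trig_mxP => i j ij; rewrite !mxE leqNgt ij.
Qed.

Lemma tnth_cumul x (j : 'I_n.+1) : tnth (lin cumul x) j = \sum_(k < n.+1 | (j <= k)%N) tnth x k.
Proof.
rewrite tnth_mktuple [RHS]big_mkcond; apply: eq_bigr => k _.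
by rewrite mxE; case: leqP => _; rewrite ?mul1r ?mul0r.
Qed.

Lemma cube_subset_simplices :
  [set x : T | forall j, 0 <= tnth x j <= 1] `<=`
  [set x | exists2 s : 'S_n.+1, s \in index_enum _ & (lin (perm_mx s *m cumul) @` simplex) x].
Proof.
move=> y y01.
have /tuple_permP[q qP] : perm_eq (sort >=%O y) y by rewrite perm_sort.
pose z : nat -> R := nth 0 (sort >=%O y).
have sz : size (sort >=%O y) = n.+1 by rewrite size_sort size_tuple.
have zq (i : 'I_n.+1) : z i = tnth y (q i).
  rewrite /z qP (nth_map ord0) ?size_enum_ord//.
  by rewrite nth_ord_enum.
have z0 i : 0 <= z i.
  have [iN|Ni] := ltnP i n.+1; last by rewrite /z nth_default// sz.
  by rewrite (zq (Ordinal iN)); case/andP: (y01 (q (Ordinal iN))).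
have zdec i : z i.+1 <= z i.
  have [iN|Ni] := ltnP i.+1 n.+1; last by rewrite {1}/z nth_default// sz.
  have := sort_sorted (@ge_total _ R) y => /(sortedP 0) /(_ i).
  by rewrite sz; exact.
(* Differences of the sorted coordinates invert [cumul]; the default 0 of [nth] makes the last
   difference the smallest coordinate itself. *)
pose x : T := [tuple z j - z j.+1 | j < n.+1].
have tel (j : 'I_n.+1) : \sum_(k < n.+1 | (j <= k)%N) tnth x k = z j.
  under eq_bigr do rewrite tnth_mktuple.
  rewrite -(big_mkord (fun k => (j <= k)%N) (fun k => z k - z k.+1)).
  rewrite (@big_cat_nat _ _ _ j)//= ?(ltnW (ltn_ord j))//.
  rewrite big_nat_cond big1 ?add0r; last by move=> i /andP[/andP[_ /ltn_geF ->]].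
  rewrite big_nat_cond (eq_bigl (fun i => (j <= i < n.+1)%N)); last first.
    by move=> i; case: (j <= i)%N; rewrite ?andbT ?andbF.
  rewrite -big_nat -[LHS]opprK -sumrN; under eq_bigr do rewrite opprB.
  rewrite telescope_sumr ?(ltnW (ltn_ord j))// [z n.+1]nth_default ?sz//.
  by rewrite sub0r opprK.
exists (q^-1)%g; first exact: mem_index_enum.
exists x.
  split=> [j|]; first by rewrite tnth_mktuple subr_ge0.
  rewrite (_ : \sum_j _ = z 0%N); first by rewrite (zq ord0); case/andP: (y01 (q ord0)).
  by rewrite -(tel ord0); apply: eq_bigl => k; rewrite leq0n.
apply: eq_from_tnth => j; rewrite lin_mul lin_perm tnth_mktuple tnth_cumul tel zq.
by rewrite permKV.
Qed.

Lemma fin_simplex : mu simplex \is a fin_num.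
Proof.
rewrite ge0_fin_numE ?lebesgue_vol_ge0//.
apply: (@le_lt_trans _ _ (box_vol [tuple 0 | j < n.+1] [tuple 1 | j < n.+1] : \bar R)); last exact: ltry.
apply: lebesgue_vol_le_box => [j|x [x0 x1] j]; rewrite !tnth_mktuple ?ler01// x0/=.
by apply: le_trans x1; rewrite (bigD1 j)//= lerDl sumr_ge0.
Qed.

Lemma simplex_vol_ge : ((n.+1)`!%:R^-1%:E <= mu simplex)%E.
Proof.
rewrite -[leRHS](fineK fin_simplex) lee_fin -[leLHS]mul1r ler_pdivrMr ?ltr0n ?fact_gt0//.
have h : (\sum_(s : 'S_n.+1) mu (lin (perm_mx s *m cumul) @` simplex) <=
    \sum_(s : 'S_n.+1) (fine (mu simplex))%:E)%E.
  apply: lee_sum => s _; apply: le_trans (le_lin_vol _ _) _.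
  by rewrite det_mulmx det_cumul mulr1 det_perm normrX normrN1 expr1n mul1e fineK// fin_simplex.
have := le_trans (le_trans (lebesgue_vol_cube R n) (le_lebesgue_vol cube_subset_simplices))
  (le_trans (lebesgue_vol_bigU _ _) h).
by rewrite sumEFin lee_fin sumr_const card_Sn mulr_natr.
Qed.

Lemma osimplex_sub : osimplex `<=` simplex.
Proof. by move=> x [x0 x1]; split => [j|]; apply: ltW. Qed.

Lemma splits_osimplex : splits osimplex.
Proof.
(* The first row of ones turns the bound on the coordinate sum into a coordinate half-space. *)
pose S : 'M[R]_n.+1 := \matrix_(i, j) if i == ord0 then 1 else (i == j)%:R.
have uS : S \in unitmx.
  rewrite unitmxE -det_tr det_trig; last first.
    apply/is_trig_mxP => i j ij; rewrite !mxE -!val_eqE/= (gtn_eqF ij) gtn_eqF//.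
    exact: leq_ltn_trans ij.
  by rewrite big1 ?unitr1// => i _; rewrite !mxE eqxx if_same.
have := splits_setI (splits_bigI (index_enum 'I_n.+1) (fun j => splits_halfspace_gt j 0))
  (splits_preimage_lin uS (splits_halfspace_lt ord0 1)).
congr splits; apply/seteqP.
have e x : tnth (lin S x) ord0 = \sum_j tnth x j.
  by rewrite tnth_mktuple; apply: eq_bigr => j _; rewrite mxE eqxx mul1r.
by split => x /= [x0]; rewrite e => x1; split => // j; apply: x0; exact: mem_index_enum.
Qed.

(** The permuted images of the open simplex under the unimodular map [cumul] are disjoint, lie in
    the unit cube, and number [(n.+1)!]. *)
Lemma osimplex_vol_le : (mu osimplex <= (n.+1)`!%:R^-1%:E)%E.
Proof.
have fo : mu osimplex \is a fin_num.
  rewrite ge0_fin_numE ?lebesgue_vol_ge0//.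
  apply: le_lt_trans (le_lebesgue_vol osimplex_sub) _.
  by rewrite -ge0_fin_numE ?lebesgue_vol_ge0// fin_simplex.
rewrite -[leLHS](fineK fo) lee_fin -[leRHS]mul1r ler_pdivlMr ?ltr0n ?fact_gt0//.
pose M (s : 'S_n.+1) := perm_mx s *m cumul.
have dM s : `|\det (M s)| = 1.
  by rewrite det_mulmx det_cumul mulr1 det_perm normrX normrN1 expr1n.
have uM s : M s \in unitmx by rewrite unitmxE unitfE -normr_eq0 dM oner_eq0.
pose O s : set T := lin (invmx (M s)) @^-1` osimplex.
have OE s : O s = lin (M s) @` osimplex.
  apply/seteqP; split => [x Ox|_ [x xo <-]].
    by exists (lin (invmx (M s)) x) => //; rewrite -lin_mul mulmxV// lin1.
  by rewrite /O/= -lin_mul mulVmx// lin1.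
(* The coordinates of such a [y] are distinct, and the permutation is read off from their ranks;
   this gives disjointness. *)
have rk s y j : O s y -> s j = #|[pred l | tnth y j < tnth y l]| :> nat.
  rewrite OE => -[x [x0 x1] <-].
  have e l : tnth (lin (M s) x) l = \sum_(k < n.+1 | (s l <= k)%N) tnth x k.
    by rewrite lin_mul lin_perm tnth_mktuple tnth_cumul.
  have lt (i k : 'I_n.+1) : (\sum_(l < n.+1 | (i <= l)%N) tnth x l <
      \sum_(l < n.+1 | (k <= l)%N) tnth x l) = (k < i)%N.
    have le (a b : 'I_n.+1) : (a <= b)%N -> \sum_(l < n.+1 | (b <= l)%N) tnth x l <=
        \sum_(l < n.+1 | (a <= l)%N) tnth x l.
      move=> ab; rewrite big_mkcond [leRHS]big_mkcond; apply: ler_sum => l _.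
      by case: (leqP b l) => [/(leq_trans ab) -> //|_]; case: ifP => // _; exact/ltW.
    have [ki|ik] := ltnP k i; last by apply/negbTE; rewrite -leNgt le.
    rewrite [ltRHS](bigD1 k)//= ltr_pwDl// big_mkcond [leRHS]big_mkcond.
    apply: ler_sum => l _; case: (leqP i l) => [il|_]; last by case: ifP => // _; exact/ltW.
    by rewrite (ltnW (leq_trans ki il)) -val_eqE/= gtn_eqF// (leq_trans ki).
  transitivity (\sum_(l < n.+1 | (l < s j)%N) 1)%N.
    by rewrite (big_ord_narrow (ltnW (ltn_ord (s j))))/= sum1_card card_ord.
  rewrite [LHS](reindex_inj (@perm_inj _ s)) -sum1_card.
  by apply: eq_bigl => l; rewrite inE !e lt.
have disj s t x : s \in index_enum _ -> t \in index_enum _ -> O s x -> O t x -> s = t.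
  move=> + + Os Ot => _ _; apply/permP => j; apply: val_inj => /=.
  by rewrite (rk _ _ _ Os) (rk _ _ _ Ot).
have sO s : splits (O s).
  by apply: splits_preimage_lin; [rewrite unitmx_inv|exact: splits_osimplex].
have sub : [set x | exists2 s, s \in index_enum _ & O s x] `<=`
    box [tuple 0 | j < n.+1] [tuple 1 | j < n.+1].
  move=> y [s sin]; rewrite OE => -[x [x0 x1] <-] j.
  have -> : tnth (lin (M s) x) j = \sum_(k < n.+1 | (s j <= k)%N) tnth x k.
    by rewrite lin_mul lin_perm tnth_mktuple tnth_cumul.
  rewrite !tnth_mktuple.
  rewrite sumr_ge0 => [|k _]; last exact/ltW.
  apply: le_trans (ltW x1); rewrite [leRHS](bigID (fun k : 'I__ => s j <= k)%N)/=.
  by rewrite lerDl sumr_ge0// => k _; exact/ltW.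
have b01 : is_box [tuple 0 | j < n.+1] ([tuple 1 | j < n.+1] : T).
  by move=> j; rewrite !tnth_mktuple ler01.
have := le_trans (splits_disjoint (index_enum_uniq _) sO disj)
  (le_trans (le_lebesgue_vol sub) (lebesgue_vol_le_box b01 (@subset_refl _ _))).
rewrite (_ : box_vol _ _ = 1%E); last first.
  by rewrite /box_vol big1// => j _; rewrite !tnth_mktuple subr0.
under eq_bigr do rewrite OE lin_vol// dM mul1e -(fineK fo).
rewrite sumEFin lee_fin sumr_const card_Sn.
by rewrite mulr_natr.
Qed.

(** Half of the slack [1 - s] is distributed evenly over the coordinates: each becomes positive and
    the sum stays below 1. *)
Lemma dilated_simplex_subset (s : R) : 0 <= s < 1 ->
  translate [tuple (1 - s) / (2 * n.+1%:R) | j < n.+1] @` (lin s%:M @` simplex) `<=` osimplex.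
Proof.
move=> /andP[s0 s1] _ [_ [x [x0 x1] <-] <-].
have e j : tnth (translate [tuple (1 - s) / (2 * n.+1%:R) | j < n.+1] (lin s%:M x)) j =
    (1 - s) / (2 * n.+1%:R) + s * tnth x j.
  rewrite !tnth_mktuple (bigD1 j)//= mxE eqxx mulr1n big1 ?addr0// => k kj.
  by rewrite mxE eq_sym (negPf kj) mul0r.
have p : 0 < (1 - s) / (2 * n.+1%:R) by rewrite divr_gt0 ?subr_gt0 ?mulr_gt0 ?ltr0n.
split=> [j|]; first by rewrite e ltr_wpDr// mulr_ge0.
rewrite (eq_bigr _ (fun j _ => e j)) big_split/= sumr_const card_ord -mulr_sumr.
rewrite -[_ *+ n.+1]mulr_natr.
have -> : (1 - s) / (2 * n.+1%:R) * n.+1%:R = (1 - s) / 2.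
  by rewrite invfM mulrA mulfVK// pnatr_eq0.
have := ler_wpM2l s0 x1; rewrite mulr1; lra.
Qed.

(** The closed simplex, shrunk by a factor [s < 1], fits into the open one; letting [s] tend to 1
    equates the volumes without measuring the boundary. *)
Lemma simplex_volE : mu simplex = (n.+1)`!%:R^-1%:E /\ mu osimplex = (n.+1)`!%:R^-1%:E.
Proof.
have ss (s : R) : 0 < s < 1 -> ((s ^+ n.+1)%:E * mu simplex <= mu osimplex)%E.
  move=> /andP[s0 s1]; have uL : s%:M \in @unitmx R n.+1.
    by rewrite unitmxE det_scalar unitrX// unitfE gt_eqF.
  have := le_lebesgue_vol (@dilated_simplex_subset s (introT andP (conj (ltW s0) s1))).
  by rewrite translate_vol lin_vol// det_scalar ger0_norm// exprn_ge0// ltW.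
suff : (mu simplex <= mu osimplex)%E.
  move=> h; split; apply/eqP; rewrite eq_le.
    by rewrite simplex_vol_ge andbT (le_trans h osimplex_vol_le).
  by rewrite osimplex_vol_le/= (le_trans simplex_vol_ge h).
have fo : mu osimplex \is a fin_num.
  rewrite ge0_fin_numE ?lebesgue_vol_ge0//.
  exact: le_lt_trans osimplex_vol_le (ltry _).
rewrite -(fineK fo) -(fineK fin_simplex) lee_fin.
have cv : (fun k : nat => (1 - k.+1%:R^-1 : R) ^+ n.+1 * fine (mu simplex)) @ \oo -->
    (1 - 0 : R) ^+ n.+1 * fine (mu simplex).
  apply: cvgM; last exact: cvg_cst.
  apply: (cvg_comp (fun k : nat => 1 - k.+1%:R^-1 : R) (fun x : R => x ^+ n.+1)); last exact: exprn_continuous.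
  by apply: cvgB; [exact: cvg_cst|exact: cvg_harmonic].
rewrite subr0 expr1n mul1r in cv.
apply: cvgr_to_le cv _; exists 1%N => // k /= k1.
have k0 : (0 : R) < 1 - k.+1%:R^-1 by rewrite subr_gt0 invf_lt1 ?ltr0n// ltr1n ltnS.
have k1' : (1 - k.+1%:R^-1 : R) < 1 by rewrite ltrBlDr ltrDl invr_gt0 ltr0n.
have := ss _ (introT andP (conj k0 k1')).
by rewrite -(fineK fo) -(fineK fin_simplex) -EFinM lee_fin.
Qed.

End Simplex.

(** * Generalised Vandermonde determinants *)

Section GeneralizedVandermonde.
Variable R : realFieldType.

(** The order of the differences makes it positive on decreasing sequences, in accordance with
    decreasing exponents. *)
Definition vdm (n : nat) (z : nat -> R) : R := \prod_(j < n) \prod_(i < j) (z i - z j).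

Lemma vdmS n z : vdm n.+1 z = vdm n z * \prod_(i < n) (z i - z n).
Proof. by rewrite /vdm big_ord_recr. Qed.

(** Multilinearity of the determinant in its columns. *)
Lemma det_sum_monomials n K (c : 'I_n -> 'I_K -> R) (f : 'I_n -> 'I_K -> nat) (z : nat -> R) :
  \det (\matrix_(i < n, j < n) \sum_(k < K) c j k * z i ^+ f j k) =
  \sum_(g : {ffun 'I_n -> 'I_K}) (\prod_j c j (g j)) *
     \det (\matrix_(i < n, j < n) z i ^+ f j (g j)).
Proof.
rewrite -det_tr {1}/determinant.
under eq_bigr => s _.
  under eq_bigr do rewrite !mxE.
  rewrite bigA_distr_bigA mulr_sumr; over.
rewrite exchange_big; apply: eq_bigr => g _ /=.
rewrite -[X in _ = _ * X]det_tr mulr_sumr; apply: eq_bigr => s _.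
rewrite big_split/= mulrCA; congr (_ * (_ * _)).
by apply: eq_bigr => j _; rewrite !mxE.
Qed.

(* Subtracting [z n ^ (e j - e j.+1)] times column [j.+1] from column [j] clears
   the last row and makes [z i - z n] divide row [i]. *)
Lemma det_monomials_recr n (e : nat -> nat) (z : nat -> R) :
  (forall j, (j < n)%N -> (e j.+1 < e j)%N) ->
  \det (\matrix_(i < n.+1, j < n.+1) z i ^+ e j) =
  z n ^+ e n * \prod_(i < n) (z i - z n) *
  \det (\matrix_(i < n, j < n) \sum_(k < (e 0%N).+1)
     (k < e j - e j.+1)%:R * z n ^+ k * z i ^+ (e j - k.+1)).
Proof.
move=> edec; set a := z n.
pose B : 'M[R]_n.+1 := \matrix_(i, j) ((i == j)%:R - (i == j.+1 :> nat)%:R * a ^+ (e j - e j.+1)).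
have dB : \det B = 1.
  rewrite det_trig; last first.
    apply/is_trig_mxP => i j ij; rewrite mxE -val_eqE/= (ltn_eqF ij) (ltn_eqF (leqW ij)) ?mul0r ?subr0//.
  by rewrite big1// => i _; rewrite mxE eqxx (ltn_eqF (leqnn _)) mul0r subr0.
set M := \matrix_(i, j) _.
have MB i j : (M *m B) i j = z i ^+ e j - (j < n)%:R * (z i ^+ e j.+1 * a ^+ (e j - e j.+1)).
  rewrite mxE; under eq_bigr do rewrite !mxE mulrBr.
  rewrite sumrB; congr (_ - _).
    rewrite (bigD1 j)//= eqxx mulr1 big1 ?addr0// => k /negPf kj.
    by rewrite kj mulr0.
  have [jn|nj] := ltnP j n; last first.
    rewrite mul0r big1// => k _; rewrite (_ : (k == _ :> nat) = false) ?mul0r ?mulr0//.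
    by rewrite ltn_eqF// (leq_trans (ltn_ord k)).
  have jn1 : (j.+1 < n.+1)%N by [].
  rewrite (bigD1 (Ordinal jn1))//= eqxx !mul1r big1 ?addr0// => k.
  by rewrite -val_eqE/= => /negPf ->; rewrite mul0r mulr0.
rewrite -[LHS]mulr1 -[X in _ * X = _]dB -det_mulmx (expand_det_row _ ord_max) (bigD1 ord_max)//=.
rewrite big1 ?addr0 => [|j jm]; last first.
  have jn : (j < n)%N by rewrite ltn_neqAle -ltnS ltn_ord andbT; exact: jm.
  rewrite MB/= jn mul1r -exprD subnKC ?subrr ?mul0r//; exact/ltnW/edec.
rewrite MB/= ltnn mul0r subr0 -mulrA; congr (_ * _).
rewrite /cofactor addnn -signr_odd odd_double mul1r.
rewrite (_ : row' ord_max (col' ord_max (M *m B)) = diag_mx (\row_i (z i - a)) *m \matrix_(i < n, j < n) \sum_(k < (e 0%N).+1)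
     (k < e j - e j.+1)%:R * a ^+ k * z i ^+ (e j - k.+1)).
  by rewrite det_mulmx det_diag; congr (_ * _); apply: eq_bigr => i _; rewrite mxE.
apply/matrixP => i j; rewrite mul_diag_mx [row' _ _ _ _]mxE [col' _ _ _ _]mxE MB !mxE.
rewrite !lift_max ltn_ord mul1r.
have ej := edec j (ltn_ord j).
rewrite -{1}(subnK (ltnW ej)) exprD mulrC -mulrBr subrXX mulrCA; congr (_ * _).
(* The indicator pads the geometric sum to a range that does not depend on [j], as
   [det_sum_monomials] requires. *)
have dle : (e j - e j.+1 <= (e 0%N).+1)%N.
  have e0 k : (k <= n)%N -> (e k <= e 0%N)%N.
    by elim: k => // k IH kn; apply: leq_trans (IH (ltnW kn)); exact/ltnW/edec.
  by rewrite (leq_trans (leq_subr _ _))// leqW// e0// ltnW.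
rewrite (big_ord_widen_cond _ xpredT (fun i0 => z i ^+ ((e j - e j.+1).-1 - i0) * a ^+ i0) dle).
rewrite mulr_sumr big_mkcond; apply: eq_bigr => k _.
case: ltnP => kd; last by rewrite !mul0r.
rewrite mul1r [a ^+ k * _]mulrC mulrA -exprD; congr (_ ^+ _ * _).
by move: kd ej; move: (e j) (e j.+1) (nat_of_ord k); clear; lia.
Qed.

Lemma gen_vandermonde_gt0 n (e : nat -> nat) (z : nat -> R) :
  (forall j, (j.+1 < n)%N -> (e j.+1 < e j)%N) ->
  (forall i, (i < n)%N -> 0 < z i \/ [/\ z i = 0, i.+1 = n & e i = 0%N]) ->
  exists2 s, 0 < s & \det (\matrix_(i < n, j < n) z i ^+ e j) = s * vdm n z.
Proof.
elim: n e z => [|n IH] e z edec zpos.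
  by exists 1 => //; rewrite det_mx00 /vdm big_ord0 mulr1.
have zn0 : 0 < z n ^+ e n.
  by have [zn|[-> _ ->]] := zpos n (ltnSn n); [exact: exprn_gt0|rewrite expr0].
have z0 i : (i < n)%N -> 0 < z i.
  move=> iN; have [//|[_ ein _]] := zpos i (ltnW iN).
  by move: iN; rewrite -ltnS ein ltnn.
have zn_ge0 : 0 <= z n by have [/ltW|[-> _ _]] := zpos n (ltnSn n).
rewrite det_monomials_recr => [|j jn]; last exact: edec.
set K := (e 0%N).+1; set d := fun j => (e j - e j.+1)%N.
have h (g : {ffun 'I_n -> 'I_K}) : exists s, 0 < s /\ ((forall j, (g j < d j)%N) ->
    \det (\matrix_(i < n, j < n) z i ^+ (e j - (g j).+1)) = s * vdm n z).
  (* For any other [g] the weight is 0, and an arbitrary positive value will do. *)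
  have [gd|ngd] := pselect (forall j, (g j < d j)%N); last by exists 1; split.
  have [||s s0 ds] := IH (fun j => if insub j is Some j' then (e j - (g j').+1)%N else 0%N) z.
  - move=> j jn; rewrite (insubT (fun k => k < n)%N jn) (insubT (fun k => k < n)%N (ltnW jn)).
    move: (gd (Ordinal jn)) (gd (Ordinal (ltnW jn))) (edec j) (edec j.+1).
    by rewrite /d/= !ltnS jn (ltnW jn); move: (nat_of_ord (g _)) (nat_of_ord (g _)); lia.
  - by move=> i iN; left; exact: z0.
  exists s; split=> // _; rewrite -ds; congr (\det _); apply/matrixP => i j; rewrite !mxE.
  by rewrite valK.
have [s sP] := choice h.
have -> : \det (\matrix_(i < n, j < n) \sum_(k < K) (k < d j)%:R * z n ^+ k * z i ^+ (e j - k.+1)) =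
   (\sum_(g : {ffun 'I_n -> 'I_K}) (\prod_j ((g j < d j)%:R * z n ^+ g j)) * s g) * vdm n z.
  rewrite (det_sum_monomials (fun j k => (k < d j)%:R * z n ^+ k) (fun j k => (e j - k.+1)%N)).
  rewrite mulr_suml; apply: eq_bigr => g _; rewrite -mulrA.
  have [gd|/existsNP[j /negP jd]] := pselect (forall j, (g j < d j)%N).
    by rewrite (sP g).2.
  by rewrite (bigD1 j)//= (negPf jd) !mul0r.
exists (z n ^+ e n * (\sum_(g : {ffun 'I_n -> 'I_K}) (\prod_j ((g j < d j)%:R * z n ^+ g j)) * s g)).
  (* The term with all powers of [z n] equal to 1 is positive even when [z n] is 0. *)
  rewrite mulr_gt0// (bigD1 [ffun=> ord0])//= ltr_pwDl//.
    rewrite big1 ?mul1r; first exact: (sP _).1.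
    move=> j _; rewrite ffunE/= expr0 mulr1 /d subn_gt0.
    by rewrite edec// ltnS.
  apply: sumr_ge0 => g _; rewrite mulr_ge0 ?(ltW (sP g).1)//.
  by apply: prodr_ge0 => j _; rewrite mulr_ge0// exprn_ge0.
by rewrite vdmS; ring.
Qed.

End GeneralizedVandermonde.

(** * Triangulation of the discretised hull *)

Section LinearProgram.
Variables (R : realType) (K J : nat).
Variables (a : 'I_K -> 'I_J -> R) (c : 'I_J -> R) (h : 'I_K -> R).

Definition feasible (w : 'I_K -> R) :=
  [/\ forall k, 0 <= w k, \sum_k w k = 1 & forall j, \sum_k w k * a k j = c j].

Lemma continuous_weighted_sum (f : 'I_K -> R) :
  continuous (fun w : 'rV[R]_K => \sum_k w ord0 k * f k).
Proof.
apply: continuous_big => [|k _ w]; first exact: add_continuous.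
apply: continuousM; [exact: coord_continuous|exact: cst_continuous].
Qed.

Lemma closed_weighted_sum (f : 'I_K -> R) (y : R) :
  closed [set w : 'rV[R]_K | \sum_k w ord0 k * f k = y].
Proof.
apply: (@preimage_closed _ _ (fun w : 'rV[R]_K => \sum_k w ord0 k * f k) [set y]).
  by move=> w _; exact: continuous_weighted_sum.
exact: closed_eq.
Qed.

Lemma lp_minimizer : (exists w, feasible w) ->
  exists2 w, feasible w & forall w', feasible w' -> \sum_k w k * h k <= \sum_k w' k * h k.
Proof.
move=> [w0 fw0].
pose W := [set w : 'rV[R]_K | forall k, `[0%R, 1%R]%classic (w ord0 k)] `&`
  ([set w : 'rV[R]_K | \sum_k w ord0 k * 1 = 1] `&`
   \bigcap_(j in [set: 'I_J]) [set w : 'rV[R]_K | \sum_k w ord0 k * a k j = c j]).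
have WP (w : 'I_K -> R) : W (\row_k w k) <-> feasible w.
  have rw (f : 'I_K -> R) : \sum_k (\row_k w k) ord0 k * f k = \sum_k w k * f k.
    by apply: eq_bigr => k _; rewrite mxE.
  split=> [[w01 [w1 wc]]|[w0' w1 wc]].
    split=> [k||j].
    - by have := w01 k; rewrite mxE /= in_itv/= => /andP[].
    - by rewrite -w1/= rw; apply: eq_bigr => k _; rewrite mulr1.
    - by have := wc j I; rewrite /= rw.
  split=> [k|].
    rewrite /= mxE in_itv/= w0'/= -w1 (bigD1 k)//= lerDl sumr_ge0//.
  split=> [|j _] /=; last by rewrite rw.
  by rewrite rw -[RHS]w1; apply: eq_bigr => k _; rewrite mulr1.
have cW : compact W.
  apply: compact_closedI.
    exact: (@rV_compact _ _ (fun _ : 'I_K => (`[0%R, 1%R]%classic : set R)) (fun=> @segment_compact _ _ _)).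
  apply: closedI; first exact: closed_weighted_sum.
  by apply: closed_bigI => j _; exact: closed_weighted_sum.
have [w Ww wmin] := EVT_min_rV (ex_intro _ _ ((WP w0).2 fw0)) cW
  (continuous_subspaceT (@continuous_weighted_sum h)).
have wE : w = \row_k w ord0 k by apply/rowP => k; rewrite mxE.
exists (fun k => w ord0 k); first by apply/WP; rewrite -wE; exact/set_mem.
move=> w' fw'; have := wmin (\row_k w' k) (mem_set ((WP w').2 fw')).
by rewrite [leRHS](eq_bigr (fun k => w' k * h k)) => // k _; rewrite mxE.
Qed.

Lemma exists_step (I : finType) (u g : I -> R) : (forall i, 0 <= u i) ->
  (forall i, g i < 0 -> 0 < u i) ->
  exists2 t, 0 < t & forall i, 0 <= u i + t * g i.
Proof.
move=> u0 gu.
suff [t t0 tP] : exists2 t, 0 < t & forall i, i \in index_enum I -> 0 <= u i + t * g i.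
  by exists t => // i; exact: (tP i (mem_index_enum i)).
elim: (index_enum I) => [|i s [t t0 IH]]; first by exists 1.
have [gi|gi] := leP 0 (g i).
  exists t => // j; rewrite inE => /orP[/eqP->|/IH//].
  by rewrite addr_ge0// mulr_ge0// ltW.
have ui := gu _ gi; have v0 : 0 < u i / - g i by rewrite divr_gt0// oppr_gt0.
exists (Num.min t (u i / - g i)); first by rewrite lt_min t0.
move=> j; rewrite inE => /orP[/eqP->|/IH uj].
  have : Num.min t (u i / - g i) * - g i <= u i.
    rewrite -[leRHS](@divfK _ (- g i)) ?oppr_eq0 ?lt_eqF//.
    by rewrite ler_wpM2r ?oppr_ge0 ?(ltW gi)// ge_min lexx orbT.
  by rewrite mulrN; lra.
have [gj|gj] := leP 0 (g j).
  by rewrite addr_ge0// mulr_ge0// le_min (ltW t0) (ltW v0).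
have : t * g j <= Num.min t (u i / - g i) * g j.
  by rewrite ler_wnM2r ?(ltW gj)// ge_min lexx.
lra.
Qed.

(** A dependency [g] that takes weight only from the support can be followed for a positive time
    without leaving the feasible set, so the objective cannot decrease along it. *)
Lemma lp_direction q (w : 'I_K -> R) (s : 'I_q -> 'I_K) (g : 'I_q -> R) :
  feasible w -> (forall w', feasible w' -> \sum_k w k * h k <= \sum_k w' k * h k) ->
  injective s -> \sum_i g i = 0 -> (forall j, \sum_i g i * a (s i) j = 0) ->
  (forall i, g i < 0 -> 0 < w (s i)) -> 0 <= \sum_i g i * h (s i).
Proof.
move=> [w0 w1 wc] wmin sI g0 ga gw.
have [t t0 tP] := exists_step (fun i => w0 (s i)) gw.
pose w' k := w k + t * \sum_(i | s i == k) g i.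
have ww' (f : 'I_K -> R) : \sum_k w' k * f k = \sum_k w k * f k + t * \sum_i g i * f (s i).
  under eq_bigr do rewrite mulrDl -mulrA.
  rewrite big_split/= -mulr_sumr; congr (_ + _ * _).
  rewrite [RHS](partition_big s xpredT)//=; apply: eq_bigr => k _.
  by rewrite mulr_suml; apply: eq_bigr => i /eqP ->.
have /wmin : feasible w'.
  split=> [k||j].
  - rewrite /w'; have [[i <-]|nk] := pselect (exists i, s i = k).
      by rewrite (eq_bigl (pred1 i)) ?big_pred1_eq// => i'; rewrite (inj_eq sI).
    by rewrite big1 ?mulr0 ?addr0// => i /eqP sik; case: nk; exists i.
  - have := ww' (fun=> 1); under eq_bigr do rewrite mulr1.
    move=> ->; under eq_bigr do rewrite mulr1.
    by under [X in _ + _ * X]eq_bigr do rewrite mulr1; rewrite w1 g0 mulr0 addr0.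
  - by rewrite ww' ga mulr0 addr0.
by rewrite ww' lerDl pmulr_rge0.
Qed.

End LinearProgram.

(** * Covering a finite set by few pairs of consecutive integers *)

Section Combinatorics.

(* Greedy choice from the top, pairing the largest element left with its predecessor. *)
Lemma gapped_chain_or_cover (m B : nat) (S : pred nat) :
  (forall k, S k -> (0 < k <= B)%N) ->
  (exists J : nat -> nat, (forall t, (t <= m)%N -> S (J t)) /\
     (forall t, (t < m)%N -> ((J t.+1).+1 < J t)%N)) \/
  (exists I : seq nat, [/\ (size I <= m)%N, forall k, k \in I -> (k < B)%N &
     forall k, S k -> (k \in I) || (k.-1 \in I)]).
Proof.
elim: m S => [|m IH] S SB.
  have [[k Sk]|nS] := pselect (exists k, S k); first by left; exists (fun=> k); split.
  by right; exists [::]; split => // k Sk; case: nS; exists k.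
have [exS|nS] := pselect (exists k, S k); last first.
  by right; exists [::]; split => // k Sk; case: nS; exists k.
have ubS k : S k -> (k <= B)%N by move=> /SB /andP[].
case: (ex_maxnP exS ubS) => M SM Mmax.
have /andP[M0 MB] := SB _ SM.
have [|[J [JS Jgap]]|[I [sI IB IS]]] := IH (fun k => S k && (k.+1 < M)%N).
- by move=> k /andP[/SB].
- left; exists (fun t => if t is t'.+1 then J t' else M); split => -[|t] //= tm.
  + by have /andP[] := JS t tm.
  + by have /andP[] := JS 0%N (leq0n _).
  + exact: Jgap.
- right; exists (M.-1 :: I); split => [//|k|k Sk].
  + by rewrite inE => /orP[/eqP ->|/IB//]; rewrite prednK.
  + rewrite !inE; have [kM|Mk] := ltnP k.+1 M.
      by have := IS k; rewrite Sk kM => /(_ isT) /orP[] ->; rewrite ?orbT.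
    have := Mmax _ Sk; rewrite leq_eqVlt => /orP[/eqP->|kM].
      by rewrite eqxx /= orbT.
    by rewrite (_ : k = M.-1) ?eqxx//; move: Mk kM M0; clear; lia.
Qed.

Lemma superset_card (T : finType) (A : {set T}) m : (#|A| <= m <= #|T|)%N ->
  exists2 B : {set T}, A \subset B & #|B| = m.
Proof.
elim: m => [|m IH] /andP[Am mT].
  by exists A => //; apply/eqP; rewrite -leqn0.
move: Am; rewrite leq_eqVlt => /orP[/eqP <-|Am]; first by exists A.
have [|B AB Bm] := IH; first by rewrite -ltnS Am ltnW.
have : (0 < #|~: B|)%N by rewrite cardsCs finset.setCK Bm subn_gt0.
rewrite card_gt0 => /set0Pn[x]; rewrite inE => xB.
exists (x |: B)%SET; last by rewrite cardsU1 xB Bm.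
exact: fintype.subset_trans AB (finset.subsetUr _ _).
Qed.

End Combinatorics.

(** * Linear dependencies with alternating signs *)

Section Alternation.
Variable R : realFieldType.

Lemma vdm_gt0 n (z : nat -> R) :
  (forall i j, (i < j)%N -> (j < n)%N -> z j < z i) -> 0 < vdm n z.
Proof.
move=> zdec; apply: prodr_gt0 => j _; apply: prodr_gt0 => i _.
by rewrite subr_gt0 zdec.
Qed.

(** [d] consists of the cofactors of column 0: they annihilate the other columns and pair with
    column 0 to the determinant. The minors are again positive generalised Vandermonde determinants,
    so only the checkerboard signs remain. *)
Lemma alternating_dependency q (e : nat -> nat) (z : nat -> R) :
  (forall j, (j < q)%N -> (e j.+1 < e j)%N) -> e q = 0%N ->
  (forall i j, (i < j)%N -> (j <= q)%N -> z j < z i) -> 0 <= z q ->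
  exists d : 'I_q.+1 -> R, [/\ forall i : 'I_q.+1, 0 < (-1) ^+ i * d i,
    0 < \sum_i d i * z i ^+ e 0%N &
    forall j, (0 < j <= q)%N -> \sum_i d i * z i ^+ e j = 0].
Proof.
move=> edec eq0 zdec zq.
have zpos k : (k < q)%N -> 0 < z k by move=> kq; apply: le_lt_trans zq (zdec _ _ kq _).
pose M : 'M[R]_q.+1 := \matrix_(i, j) z i ^+ e j.
have MM (j : 'I_q.+1) : \sum_i cofactor M i ord0 * z i ^+ e j = \det M *+ (ord0 == j).
  have := mul_adj_mx M; move/matrixP => /(_ ord0 j); rewrite [RHS]mxE mxE => <-.
  by apply: eq_bigr => i _; rewrite !mxE.
exists (fun i => cofactor M i ord0); split => [i||j /andP[j0 jq]].
- rewrite /cofactor addn0 mulrA -exprMn mulrNN mulr1 expr1n mul1r.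
  have [|a aq|s s0] := @gen_vandermonde_gt0 R q (fun b => e b.+1) (fun a => z (bump i a)).
  + by move=> j jq; apply: edec.
  + have [bq|] := ltnP (bump i a) q; first by left; exact: zpos.
    rewrite leq_eqVlt => qb; have {}qb : bump i a = q.
      by move: qb (ltn_ord i); rewrite /bump; case: leqP; lia.
    have aq1 : a.+1 = q by move: qb aq; rewrite /bump; case: leqP; lia.
    rewrite qb; move: zq; rewrite le_eqVlt => /orP[/eqP zq|zq]; last by left.
    by right; split => //; rewrite aq1.
  + rewrite (_ : row' i _ = \matrix_(a < q, b < q) z (bump i a) ^+ e b.+1).
      move=> ->; rewrite mulr_gt0// vdm_gt0// => a b ab bq; apply: zdec.
        by move: ab; rewrite /bump; case: leqP; case: leqP; lia.
      by move: bq (ltn_ord i); rewrite /bump; case: leqP; lia.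
    by apply/matrixP => a b; rewrite !mxE.
- rewrite (MM ord0) eqxx mulr1n.
  have [//||s s0 ->] := @gen_vandermonde_gt0 R q.+1 e z.
    move=> i; rewrite ltnS leq_eqVlt => /orP[/eqP ->|iq]; last by left; exact: zpos.
    move: zq; rewrite le_eqVlt => /orP[/eqP zq|zq]; [right|by left].
    by split.
  by rewrite mulr_gt0// vdm_gt0.
- by have := MM (Ordinal (n := q.+1) (m := j) jq); rewrite -val_eqE/= ltn_eqF.
Qed.

End Alternation.

Lemma decreasing_upto (q : nat) (f : nat -> nat) :
  (forall k, (k < q)%N -> (f k.+1 < f k)%N) ->
  forall i j, (i < j)%N -> (j <= q)%N -> (f j < f i)%N.
Proof.
move=> fdec i; elim=> // j IH; rewrite ltnS leq_eqVlt => /orP[/eqP <-|ij] jq.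
  exact: fdec.
exact: ltn_trans (fdec _ jq) (IH ij (ltnW jq)).
Qed.

(** * Covering the grid polytope by simplices on paired nodes *)

Section GridCover.
Variables (R : realType) (n m N : nat) (b : bool) (e : nat -> nat).
Hypothesis n_mb : n.+1 = (2 * m + b)%N.
Hypothesis e_dec : forall j, (j < n)%N -> (e j.+1 < e j)%N.
Hypothesis e_gt0 : (0 < e n)%N.
Hypothesis N_gt0 : (0 < N)%N.
Local Notation T := (n.+1.-tuple R).
Local Notation mu := (@lebesgue_vol R n.+1).

Definition node (k : nat) : R := k%:R / N%:R.

Lemma node0 : node 0 = 0.
Proof. by rewrite /node mul0r. Qed.

Lemma nodeN : node N = 1.
Proof. by rewrite /node divff// pnatr_eq0 -lt0n. Qed.

Lemma node_ge0 k : 0 <= node k.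
Proof. by rewrite divr_ge0. Qed.

Lemma ltr_node k l : (node k < node l) = (k < l)%N.
Proof. by rewrite /node ltr_pM2r ?invr_gt0 ?ltr0n// ltr_nat. Qed.

Lemma ler_node k l : (node k <= node l) = (k <= l)%N.
Proof. by rewrite /node ler_pM2r ?invr_gt0 ?ltr0n// ler_nat. Qed.

Lemma node_inj : injective node.
Proof.
by move=> k l kl; apply/eqP; rewrite eqn_leq -!ler_node kl lexx.
Qed.

Lemma e_pos j : (j <= n)%N -> (0 < e j)%N.
Proof.
rewrite leq_eqVlt => /orP[/eqP->//|jn].
exact: leq_ltn_trans (leq0n _) (decreasing_upto e_dec jn (leqnn _)).
Qed.

Definition node_mx (c : nat -> nat) : 'M[R]_n.+1 := \matrix_(j, k) node (c k) ^+ e j.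

Definition grid_rep (x : T) : ('I_N.+1 -> R) -> Prop :=
  feasible (fun (k : 'I_N.+1) (j : 'I_n.+1) => node k ^+ e j) (tnth x).

Definition grid_hull : set T := [set x | exists w, grid_rep x w].

Lemma tnth_node_mx c (x : T) j :
  tnth (lin (node_mx c) x) j = \sum_(k < n.+1) tnth x k * node (c k) ^+ e j.
Proof. by rewrite tnth_mktuple; apply: eq_bigr => k _; rewrite mxE mulrC. Qed.

(** All exponents are positive, so node 0 is the origin and its weight becomes the slack in the
    inequality of [simplex]. As [c] may repeat a node, [phi] selects one column for each node of the
    support. *)
Lemma grid_rep_simplex (c : nat -> nat) w x : grid_rep x w ->
  (forall k : 'I_N.+1, (0 < k)%N -> 0 < w k -> exists q : 'I_n.+1, c q = k) ->
  (lin (node_mx c) @` @simplex R n) x.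
Proof.
move=> [w0 w1 wx] sup.
pose P (k : 'I_N.+1) := (0 < k)%N && (0 < w k).
have /choice[phi phiP] (k : 'I_N.+1) : exists q : 'I_n.+1, P k -> c q = k.
  have [/andP[k0 wk]|nP] := boolP (P k); last by exists ord0.
  by have [q cq] := sup k k0 wk; exists q.
exists [tuple \sum_(k | P k && (phi k == q)) w k | q < n.+1].
  split=> [q|]; first by rewrite tnth_mktuple sumr_ge0.
  under eq_bigr do rewrite tnth_mktuple.
  rewrite -(partition_big phi xpredT)//= -w1 [leRHS](bigID P)/=.
  by rewrite lerDl sumr_ge0.
apply: eq_from_tnth => j; rewrite tnth_node_mx -wx.
under eq_bigr do rewrite tnth_mktuple mulr_suml.
rewrite [RHS](bigID P)/= [X in _ = _ + X]big1 ?addr0; last first.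
  move=> k; rewrite negb_and -leqNgt leqn0 -leNgt => /orP[/eqP ->|wk].
    by rewrite node0 expr0n gtn_eqF ?mulr0// e_pos// -ltnS.
  by rewrite (_ : w k = 0) ?mul0r//; apply/eqP; rewrite eq_le wk w0.
rewrite [RHS](partition_big phi xpredT)//=; apply: eq_bigr => q _.
by apply: eq_bigr => k /andP[Pk /eqP <-]; rewrite phiP.
Qed.

(** Lists the vertices other than the origin: the two ends of pair [t] stand at [2 * t] and
    [2 * t + 1], and position [2 * m], which exists in odd dimension only, holds the node 1. *)
Definition paired (i : nat -> nat) (k : nat) : nat :=
  if (k < 2 * m)%N then (i k./2 + odd k)%N else N.

Definition set_index (A : {set 'I_N}) (t : nat) : nat := nth 0%N [seq val k | k <- enum A] t.

Lemma set_index_lt A t : (set_index A t < N)%N.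
Proof.
rewrite /set_index; have [tA|At] := ltnP t (size (enum A)).
  by rewrite (nth_map (Ordinal N_gt0))//; exact: ltn_ord.
by rewrite nth_default// size_map.
Qed.

Lemma set_index_mem (A : {set 'I_N}) (k : 'I_N) : k \in A -> exists2 t, (t < #|A|)%N & set_index A t = k.
Proof.
move=> kA; exists (index k (enum A)); first by rewrite cardE index_mem mem_enum.
by rewrite /set_index (nth_map k) ?index_mem ?mem_enum// nth_index// mem_enum.
Qed.

(* [lift_exp 0] is the exponent of the objective of the linear program, [lift_exp n.+2]
   that of the constraint on the total weight. *)
Definition lift_exp (j : nat) : nat :=
  if j is j'.+1 then (if (j' <= n)%N then e j' else 0%N) else (e 0%N).+1.

Lemma lift_exp_dec j : (j < n.+2)%N -> (lift_exp j.+1 < lift_exp j)%N.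
Proof.
case: j => [|j]; first by rewrite /lift_exp leq0n.
rewrite /lift_exp !ltnS => jn; rewrite jn; case: (ltnP j n) => [jn1|nj]; first exact: e_dec.
exact: e_pos.
Qed.

Lemma lift_exp_last : lift_exp n.+2 = 0%N.
Proof. by rewrite /= ltnn. Qed.

(** The dependency on these [n + 3] nodes, multiplied by [- (-1) ^+ b], lowers the objective. It is
    negative exactly at the positions of parity [b], all of which carry weight, so [w] could be
    improved. *)
Lemma grid_no_alternation (w : 'I_N.+1 -> R) x (kp : nat -> nat) :
  grid_rep x w ->
  (forall w', grid_rep x w' -> \sum_k w k * ((-1) ^+ b * node k ^+ (e 0%N).+1) <=
                               \sum_k w' k * ((-1) ^+ b * node k ^+ (e 0%N).+1)) ->
  (forall i, (i < n.+2)%N -> (kp i.+1 < kp i)%N) -> (kp 0%N <= N)%N ->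
  (forall i, (i <= n.+2)%N -> odd i = b -> 0 < w (inord (kp i))) -> False.
Proof.
move=> xw wmin kdec k0 wk.
have kp_dec := decreasing_upto kdec.
have kN i : (i <= n.+2)%N -> (kp i <= N)%N.
  by case: i => // i iN; apply: leq_trans k0; apply/ltnW/kp_dec.
have [||d [dsgn d0 dj]] := alternating_dependency (z := fun i => node (kp i)) lift_exp_dec lift_exp_last.
- by move=> i j ij jn; rewrite ltr_node kp_dec.
- exact: node_ge0.
pose g i := - (-1) ^+ b * d i.
pose s (i : 'I_n.+3) : 'I_N.+1 := inord (kp i).
have sE (i : 'I_n.+3) : s i = kp i :> nat by rewrite inordK// ltnS kN// -ltnS.
have h0 := lp_direction (q := n.+3) (s := s) (g := g) xw wmin.
have : 0 <= \sum_i g i * ((-1) ^+ b * node (s i) ^+ (e 0%N).+1).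
  apply: h0.
  - move=> i j /(congr1 val); rewrite /= !sE => kij; apply/val_inj.
    case: (ssrnat.ltngtP i j) => // lt.
      by have := kp_dec _ _ lt (ltn_ord j); rewrite kij ltnn.
    by have := kp_dec _ _ lt (ltn_ord i); rewrite kij ltnn.
  - rewrite -mulr_sumr; have := dj n.+2; rewrite lift_exp_last leqnn => /(_ isT) dn.
    rewrite -[RHS](mulr0 (- (-1) ^+ b)) -[X in _ = _ * X]dn; congr (_ * _).
    by apply: eq_bigr => i _; rewrite expr0 mulr1.
  - move=> j; under eq_bigr do rewrite sE -mulrA.
    have := dj j.+1 (leqW (ltn_ord j)); rewrite /lift_exp -ltnS ltn_ord => dn.
    by rewrite -mulr_sumr dn mulr0.
  - move=> i; have := dsgn i; rewrite /g => di gi.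
    apply: wk; first by rewrite -ltnS.
    move: di gi; rewrite -signr_odd.
    by case: (odd i); case: b => //=; rewrite ?expr0 ?expr1 ?opprK ?mul1r ?mulN1r; lra.
rewrite leNgt => /negP; apply.
have -> : \sum_i g i * ((-1) ^+ b * node (s i) ^+ (e 0%N).+1) =
    - \sum_i d i * node (kp i) ^+ lift_exp 0.
  rewrite -sumrN; apply: eq_bigr => i _; rewrite sE /g /=.
  by case: b; rewrite ?expr0 ?expr1; ring.
by rewrite oppr_lt0.
Qed.

Lemma grid_hull_cover x : (m <= N)%N -> grid_hull x ->
  exists2 A : {set 'I_N}, #|A| = m & (lin (node_mx (paired (set_index A))) @` @simplex R n) x.
Proof.
move=> mN xh.
have [w xw wmin] := lp_minimizer (fun k : 'I_N.+1 => (-1) ^+ b * node k ^+ (e 0%N).+1) xh.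
(* These are the nodes that the pairs have to cover: 0 is the origin, and in odd dimension [N] is a
   vertex of every simplex. *)
pose S k := [&& (0 < k)%N, (k <= N - b)%N & 0 < w (inord k)].
have SB k : S k -> (0 < k <= N - b)%N by case/and3P => -> ->.
have [[J [JS Jgap]]|[I [sI IB IS]]] := gapped_chain_or_cover m SB.
  exfalso.
  (* Each chain element is followed by its predecessor, and the gaps keep the sequence strictly
     decreasing. In odd dimension [N] is put in front, which moves the support to the odd
     positions. *)
  pose k0 k := (J k./2 - odd k)%N.
  have k0_dec k : (k < (2 * m).+1)%N -> (k0 k.+1 < k0 k)%N.
    move=> km; rewrite /k0 /= uphalf_half.
    have : (k./2 <= m)%N by rewrite -(half_bit_double m false) half_leq// -muln2 mulnC.
    have ke := odd_double_half k.
    case: (odd k) ke => /= ke kl.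
      have km' : (k./2 < m)%N by move: ke km; rewrite -muln2; lia.
      have := Jgap _ km'; rewrite add1n subn0 subn1; case: (J k./2) => //=; lia.
    have /and3P[J0 _ _] := JS _ kl; rewrite add0n subn0 subn1 prednK//.
  apply: (@grid_no_alternation w x (if b then (fun i => if i is i'.+1 then k0 i' else N) else k0)) => //.
  - move=> i iN; have : (i < 2 * m + b.+1)%N by rewrite addnS -n_mb.
    have /and3P[_ J0N _] := JS 0%N (leq0n _).
    move: J0N; case: b => [|]; last by rewrite addn1 => _; exact: k0_dec.
    case: i {iN} => [|i] J0N im; last by apply: k0_dec; move: im; lia.
    by rewrite /k0 /= subn0; move: J0N N_gt0; lia.
  - have /and3P[_ J0N _] := JS 0%N (leq0n _).
    by move: J0N; case: b => //; rewrite /k0 /= !subn0.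
  - move=> i iN; have : (i <= 2 * m + b.+1)%N by rewrite addnS -n_mb.
    have SJ k : (k <= (2 * m).+1)%N -> ~~ odd k -> 0 < w (inord (k0 k)).
      move=> km /negPf ok; rewrite /k0 ok subn0.
      by have /and3P[] : S (J k./2) by apply: JS; move: km; have := odd_double_half k; rewrite -muln2; lia.
    case: b => [|] im oi; last by apply: SJ; rewrite ?oi//; move: im; lia.
    by case: i iN im oi => // i iN im /= /negbTE oi; apply: SJ; [move: im; lia|rewrite oi].
have Im (k : 'I_N) : val k \in I -> k \in [set k : 'I_N | val k \in I]%SET by rewrite inE.
(* Fewer than [m] pairs may cover the support; further ones are added to reach exactly [m]. *)
have [|A IA Am] := @superset_card _ [set k : 'I_N | val k \in I]%SET m.
  rewrite card_ord mN andbT; apply: leq_trans sI.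
  rewrite cardE -(size_map val); apply: uniq_leq_size.
    by rewrite map_inj_uniq ?enum_uniq//; exact: val_inj.
  by move=> k /mapP[k']; rewrite mem_enum inE => ? ->.
exists A => //; apply: (grid_rep_simplex xw) => k kgt0 wk.
have [kNb|Nbk] := leqP k (N - b); last first.
  have bT : b by move: Nbk (ltn_ord k); case: b => //; rewrite subn0 ltnS; lia.
  exists ord_max; rewrite /paired /=; have : n = (2 * m)%N by move: n_mb; rewrite bT; lia.
  by move=> ->; rewrite ltnn; move: Nbk (ltn_ord k); rewrite bT; lia.
have memA (t : nat) (odd1 : bool) : (t < m)%N -> exists q : 'I_n.+1, paired (set_index A) q = (set_index A t + odd1)%N.
  move=> tm; have q_lt : (2 * t + odd1 < n.+1)%N.
    by rewrite n_mb; move: tm; case: odd1; clear; lia.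
  exists (Ordinal q_lt); rewrite /paired /=.
  have -> : (2 * t + odd1 < 2 * m)%N by move: tm; clear; case: odd1; lia.
  have -> : (2 * t + odd1)%N = (odd1 + t.*2)%N by rewrite mul2n addnC.
  by rewrite half_bit_double oddD odd_double addbF oddb.
have Ik k' : k' \in I -> exists2 t, (t < m)%N & set_index A t = k'.
  move=> kI; have kN : (k' < N)%N by apply: leq_trans (IB _ kI) (leq_subr _ _).
  have := set_index_mem (fintype.subsetP IA _ (Im (Ordinal kN) kI)).
  by rewrite Am.
have /IS/orP[/Ik|/Ik] : S k by rewrite /S kgt0 kNb inord_val.
  by move=> [t tm tk]; have [q qP] := memA t false tm; exists q; rewrite qP tk addn0.
by move=> [t tm tk]; have [q qP] := memA t true tm; exists q; rewrite qP tk addn1 prednK.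
Qed.

End GridCover.

Lemma vdm_recl (R : realFieldType) n (z : nat -> R) :
  vdm n.+1 z = \prod_(j < n) (z 0%N - z j.+1) * vdm n (fun k => z k.+1).
Proof.
rewrite /vdm big_ord_recl big_ord0 mul1r -big_split; apply: eq_bigr => j _ /=.
by rewrite big_ord_recl.
Qed.

Lemma prod_pairs (R : comNzRingType) m (f : nat -> R) :
  \prod_(k < 2 * m) f k = \prod_(t < m) (f (2 * t)%N * f (2 * t).+1).
Proof.
elim: m => [|m IH]; first by rewrite muln0 !big_ord0.
by rewrite mulnS !big_ord_recr/= IH mulrA.
Qed.

(** * Disjointness of the open simplices *)

Section OpenSimplices.
Variables (R : realType) (n m N : nat) (b : bool) (e : nat -> nat).
Hypothesis n_mb : n.+1 = (2 * m + b)%N.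
Hypothesis e_dec : forall j, (j < n)%N -> (e j.+1 < e j)%N.
Hypothesis e_gt0 : (0 < e n)%N.
Hypothesis N_gt0 : (0 < N)%N.
Local Notation T := (n.+1.-tuple R).
Local Notation mu := (@lebesgue_vol R n.+1).
Local Notation node := (@node R N).
Local Notation node_mx := (@node_mx R n N e).
Local Notation grid_hull := (@grid_hull R n N e).
Local Notation grid_rep := (@grid_rep R n N e).
Local Notation paired := (@paired m N).
Local Notation nodeN := (@nodeN R N N_gt0).
Local Notation node_inj := (@node_inj R N N_gt0).
Local Notation lift_exp := (@lift_exp n e).

Lemma det_node_mx_gt0 (c : nat -> nat) (k : 'I_n.+1) : \det (node_mx c) != 0 -> (0 < c k)%N.
Proof.
apply: contraNT; rewrite -eqn0Ngt => /eqP ck.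
rewrite (expand_det_col _ k) big1// => j _; rewrite mxE ck node0 expr0n gtn_eqF ?mul0r//.
by apply: (e_pos e_dec e_gt0); rewrite -ltnS.
Qed.

Lemma det_node_mx_inj (c : nat -> nat) (k l : 'I_n.+1) : \det (node_mx c) != 0 -> c k = c l -> k = l.
Proof.
move=> d0 ckl; apply/eqP; apply: contraNT d0 => kl.
rewrite -det_tr; apply/eqP; apply: (determinant_alternate kl) => j.
by rewrite !mxE ckl.
Qed.

(* The generalised polynomial that vanishes at the nodes of [c], normalised to have
   leading coefficient 1. *)
Lemma annihilator c : \det (node_mx c) != 0 ->
  exists C : 'I_n.+1 -> R, forall l, (0 < l)%N -> exists2 s, 0 < s &
    node l ^+ (e 0%N).+1 + \sum_j C j * node l ^+ e j =
    s * \prod_(k < n.+1) (node l - node (c k)).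
Proof.
move=> d0; set D := \det _ in d0.
have c_gt0 (k : nat) : (k < n.+1)%N -> 0 < node (c k).
  by move=> kn; rewrite -(node0 R N) ltr_node//; exact: (det_node_mx_gt0 (Ordinal kn) d0).
have [|k kn|s0 s0_gt0 Ds0] := @gen_vandermonde_gt0 R n.+1 e (fun k => node (c k)).
- by move=> j; rewrite ltnS; exact: e_dec.
- by left; exact: c_gt0.
have DE : D = s0 * vdm n.+1 (fun k => node (c k)).
  by rewrite -Ds0 /D -det_tr; congr (\det _); apply/matrixP => i j; rewrite !mxE.
(* The cofactors along the row of [node l] in the Vandermonde matrix of [node l] and the nodes of
   [c], with the exponent [(e 0).+1] added. That determinant vanishes when [node l] is a node of
   [c], and its leading coefficient is [D]. *)
pose cf (j : 'I_n.+2) := (-1) ^+ j *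
  \det (\matrix_(a < n.+1, q < n.+1) node (c a) ^+ lift_exp (bump j q)).
have cf0 : cf ord0 = D.
  rewrite /cf expr0 mul1r /D -[RHS]det_tr; congr (\det _); apply/matrixP => i j.
  by rewrite !mxE /= leq_ord.
exists (fun j => cf (lift ord0 j) / D) => l l0.
pose z k := if k is k'.+1 then node (c k') else node l.
have [j jn|[|k] kn|s s_gt0 Ms] := @gen_vandermonde_gt0 R n.+2 lift_exp z.
- by apply: (lift_exp_dec e_dec e_gt0); rewrite ltnW.
- by left; rewrite /= -(node0 R N) ltr_node.
- by left; exact: c_gt0.
exists (s / s0); first by rewrite divr_gt0.
have v0 : vdm n.+1 (fun k => node (c k)) != 0.
  by apply: contraNneq d0 => v0; rewrite DE v0 mulr0.
have {}Ms : \sum_(j < n.+2) node l ^+ lift_exp j * cf j =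
    s * (\prod_(k < n.+1) (node l - node (c k)) * vdm n.+1 (fun k => node (c k))).
  rewrite -[RHS]/(s * (\prod_(j < n.+1) (z 0%N - z j.+1) * vdm n.+1 (fun k => z k.+1))).
  rewrite -vdm_recl -Ms (expand_det_row _ ord0).
  apply: eq_bigr => j _; rewrite mxE /cofactor add0n /cf; congr (_ * (_ * \det _)).
  by apply/matrixP => a q; rewrite !mxE.
move: Ms.
rewrite [X in X = _]big_ord_recl cf0 => Ms.
apply: (mulIf d0); rewrite mulrDl mulr_suml [RHS]mulrAC [in RHS]DE.
rewrite (_ : s / s0 * _ * _ = s * (\prod_(k < n.+1) (node l - node (c k)) * vdm n.+1 (fun k => node (c k)))).
  rewrite -Ms /=; congr (_ + _); apply: eq_bigr => j _.
  by rewrite leq_ord add0n; field.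
by rewrite /=; field; rewrite gt_eqF.
Qed.

(** No node lies strictly between the ends of a pair, so each pair contributes a nonnegative
    product; in odd dimension the factor from node 1 is at most 0. *)
Lemma pairs_sign i (l : nat) : (l <= N)%N -> 0 <= (-1) ^+ b * \prod_(k < n.+1) (node l - node (paired i k)).
Proof.
move=> lN; pose f k := node l - node (paired i k).
have h : 0 <= \prod_(k < 2 * m) f k.
  rewrite prod_pairs; apply: prodr_ge0 => t _; rewrite /f /paired.
  have -> : (2 * t < 2 * m)%N by rewrite ltn_mul2l ltn_ord.
  have -> : ((2 * t).+1 < 2 * m)%N by have := ltn_ord t; lia.
  have e1 : (2 * t)./2 = t by rewrite mul2n doubleK.
  have e2 : (2 * t).+1./2 = t by rewrite mul2n /= uphalf_double.
  rewrite e1 e2 /= mul2n odd_double addn0 addn1.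
  have [lt|lt] := leqP l (i t).
    by rewrite mulr_le0// subr_le0 ler_node// leqW.
  by rewrite mulr_ge0// subr_ge0 ler_node// ltnW.
rewrite (_ : \prod_(k < n.+1) _ = \prod_(k < 2 * m + b) f k); last by rewrite -n_mb.
case: b => /=; last by rewrite addn0 expr0 mul1r.
rewrite addn1 big_ord_recr/= expr1 mulN1r -mulrN mulr_ge0// /f /paired ltnn nodeN opprB subr_ge0.
by rewrite -nodeN ler_node.
Qed.

(** [H] is the height at which a simplex lifts [x]. The annihilator of [c] differs from the height
    by a combination of the coordinates, so averaging it over both representations of [x] gives the
    difference of heights as a sum of terms of one sign. If that sum is 0, every term is, and the
    annihilator vanishes only at nodes of [c]. *)
Lemma open_simplices_compare (i c' : nat -> nat) x y y' :
  let c := paired i in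
  (forall k : 'I_n.+1, (c' k <= N)%N) ->
  \det (node_mx c) != 0 -> \det (node_mx c') != 0 ->
  @osimplex R n y -> lin (node_mx c) y = x -> @osimplex R n y' -> lin (node_mx c') y' = x ->
  let H (c : nat -> nat) (y : T) := \sum_(k < n.+1) tnth y k * node (c k) ^+ (e 0%N).+1 in
  0 <= (-1) ^+ b * (H c' y' - H c y) /\
  (H c' y' = H c y -> forall k' : 'I_n.+1, exists k : 'I_n.+1, c' k' = c k).
Proof.
move=> c c'N d0 d0' [y0 _] yx [y0' _] yx' H.
have [C CP] := annihilator d0.
pose F l := node l ^+ (e 0%N).+1 + \sum_j C j * node l ^+ e j.
have sumF c0 (u : T) : lin (node_mx c0) u = x ->
    \sum_(k < n.+1) tnth u k * F (c0 k) = H c0 u + \sum_j C j * tnth x j.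
  move=> <-; rewrite /H; under eq_bigr do rewrite mulrDr mulr_sumr.
  rewrite big_split/= exchange_big/=; congr (_ + _); apply: eq_bigr => j _.
  rewrite tnth_node_mx mulr_sumr; apply: eq_bigr => k _; ring.
have F0 : \sum_(k < n.+1) tnth y k * F (c k) = 0.
  apply: big1 => k _; rewrite /F.
  have [s _ ->] := CP _ (det_node_mx_gt0 k d0).
  by rewrite (bigD1 k)//= subrr mul0r !mulr0.
have E : H c' y' - H c y = \sum_(k < n.+1) tnth y' k * F (c' k).
  by have := sumF _ _ yx; rewrite F0 (sumF _ _ yx'); lra.
have pos (k : 'I_n.+1) : 0 <= (-1) ^+ b * (tnth y' k * F (c' k)).
  have [s s0 sE] := CP _ (det_node_mx_gt0 k d0').
  rewrite /F sE mulrCA; apply: mulr_ge0; first exact: ltW.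
  by rewrite mulrCA; apply: mulr_ge0; [exact: ltW|exact: pairs_sign].
split=> [|HH k']; first by rewrite E mulr_sumr sumr_ge0.
have : \sum_(k < n.+1) (-1) ^+ b * (tnth y' k * F (c' k)) = 0.
  by rewrite -mulr_sumr -E HH subrr mulr0.
move/eqP; rewrite psumr_eq0// => /allP/(_ k' (mem_index_enum _))/=.
have [s s0 sE] := CP _ (det_node_mx_gt0 k' d0').
rewrite /F sE !mulf_eq0 signr_eq0 (gt_eqF (y0' k')) (gt_eqF s0)/= => /prodf_eq0[k _].
by rewrite subr_eq0 => /eqP/node_inj ?; exists k.
Qed.

Lemma paired_even i t : (t < m)%N -> paired i (2 * t) = i t.
Proof.
by move=> tm; rewrite /paired ltn_mul2l tm/= mul2n doubleK odd_double addn0.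
Qed.

Lemma paired_odd i t : (t < m)%N -> paired i (2 * t).+1 = (i t).+1.
Proof.
move=> tm; rewrite /paired (_ : (_ < _)%N); last by rewrite !mul2n -ltn_half_double /= uphalf_double.
by rewrite mul2n /= uphalf_double odd_double addn1.
Qed.

Lemma paired_le i (k : nat) : (forall t, (t < m)%N -> (i t < N)%N) -> (paired i k <= N)%N.
Proof.
move=> iN; rewrite /paired; case: ifP => // km.
have : (k./2 < m)%N by rewrite ltn_half_double -mul2n.
by move/iN; case: (odd k); rewrite ?addn1 ?addn0// => /ltnW.
Qed.

Lemma set_index_in (A : {set 'I_N}) t : #|A| = m -> (t < m)%N ->
  exists2 k : 'I_N, k \in A & set_index A t = k.
Proof.
move=> Am tm; have tA : (t < size (enum A))%N by rewrite -cardE Am.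
exists (nth (Ordinal N_gt0) (enum A) t); first by rewrite -mem_enum mem_nth.
by rewrite /set_index (nth_map (Ordinal N_gt0)).
Qed.

(** If [v] were the upper end of a pair of [B], its predecessor would be in [B], hence in [A]. Then
    [v] would be both an upper and a lower end in [A], that is, a repeated column of a nonsingular
    matrix. *)
Lemma pairs_determine_mem (A B : {set 'I_N}) (v : 'I_N) : #|A| = m -> #|B| = m ->
  \det (node_mx (paired (set_index A))) != 0 ->
  (forall k : 'I_n.+1, exists k' : 'I_n.+1, paired (set_index A) k = paired (set_index B) k') ->
  (forall u : 'I_N, (u < v)%N -> u \in B -> u \in A) -> v \in A -> v \in B.
Proof.
move=> Am Bm dA AB IH vA.
have two (t : nat) (o : bool) : (t < m)%N -> (2 * t + o < n.+1)%N.
  by rewrite n_mb; case: o; lia.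
have [t tm tv] := set_index_mem vA; rewrite Am in tm.
have t0 := two t false tm; rewrite addn0 in t0.
have [k' ] := AB (Ordinal t0); rewrite /= paired_even// tv {1}/paired.
case: ifP => [km|_ vN]; last by have := ltn_ord v; rewrite vN ltnn.
have k2 : (k'./2 < m)%N by rewrite ltn_half_double -mul2n.
have [u uB ->] := set_index_in Bm k2.
case: (odd k') => vu; last by rewrite addn0 in vu; rewrite (val_inj vu).
have uA : u \in A by apply: IH => //; rewrite vu addn1.
have [t' t'm t'u] := set_index_mem uA; rewrite Am in t'm.
have t1 := two t' true t'm; rewrite addn1 in t1.
have : paired (set_index A) (Ordinal t0) = paired (set_index A) (Ordinal t1).
  by rewrite /= paired_even// paired_odd// tv t'u vu addn1.
by move/(det_node_mx_inj dA) => /(congr1 val) /= /(congr1 odd); rewrite !mul2n /= !odd_double.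
Qed.

Lemma open_simplices_disjoint (A B : {set 'I_N}) x : #|A| = m -> #|B| = m ->
  \det (node_mx (paired (set_index A))) != 0 -> \det (node_mx (paired (set_index B))) != 0 ->
  (lin (node_mx (paired (set_index A))) @` @osimplex R n) x ->
  (lin (node_mx (paired (set_index B))) @` @osimplex R n) x -> A = B.
Proof.
move=> Am Bm dA dB [y yo yx] [y' yo' yx'].
have leN (C : {set 'I_N}) (k : 'I_n.+1) : (paired (set_index C) k <= N)%N.
  by apply: paired_le => t _; apply: set_index_lt.
have [h1 e1] := open_simplices_compare (leN B) dA dB yo yx yo' yx'.
have [h2 e2] := open_simplices_compare (leN A) dB dA yo' yx' yo yx.
have HH : \sum_(k < n.+1) tnth y' k * node (paired (set_index B) k) ^+ (e 0%N).+1 =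
          \sum_(k < n.+1) tnth y k * node (paired (set_index A) k) ^+ (e 0%N).+1.
  by move: h1 h2; case: b; rewrite ?expr0 ?expr1; lra.
have {}e1 := e1 HH; have {}e2 := e2 (esym HH).
suff mem v : forall k : 'I_N, (k < v)%N -> (k \in A) = (k \in B).
  by apply/setP => k; apply: (mem k.+1).
elim: v => // v IH k; rewrite ltnS => kv.
by apply/idP/idP; apply: pairs_determine_mem => // u uk; rewrite IH//; apply: leq_trans kv.
Qed.

End OpenSimplices.

Section SimplexImages.
Variables (R : realType) (n : nat).
Local Notation T := (n.+1.-tuple R).
Local Notation mu := (@lebesgue_vol R n.+1).

Lemma vol_lin_simplex (L : 'M[R]_n.+1) :
  mu (lin L @` @simplex R n) = (`|\det L| / (n.+1)`!%:R)%:E.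
Proof.
have [uL|] := boolP (L \in unitmx); first by rewrite lin_vol// (simplex_volE R n).1 EFinM.
rewrite unitmxE unitfE negbK => /eqP d0; rewrite d0 normr0 mul0r.
apply/eqP; rewrite eq_le lebesgue_vol_ge0 andbT.
by apply: le_trans (le_lin_vol _ _) _; rewrite d0 normr0 mul0e.
Qed.

Lemma vol_lin_osimplex (L : 'M[R]_n.+1) : L \in unitmx ->
  mu (lin L @` @osimplex R n) = (`|\det L| / (n.+1)`!%:R)%:E.
Proof. by move=> uL; rewrite lin_vol// (simplex_volE R n).2 EFinM. Qed.

Lemma splits_lin_osimplex (L : 'M[R]_n.+1) : L \in unitmx -> splits (lin L @` @osimplex R n).
Proof.
move=> uL; rewrite (_ : _ @` _ = lin (invmx L) @^-1` @osimplex R n).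
  by apply: splits_preimage_lin; [rewrite unitmx_inv|exact: splits_osimplex].
apply/seteqP; split => [_ [x xo <-]|x xo].
  by rewrite /= -lin_mul mulVmx// lin1.
by exists (lin (invmx L) x) => //; rewrite -lin_mul mulmxV// lin1.
Qed.

Lemma splits_set0 : splits (set0 : set T).
Proof. by move=> X; rewrite setI0 setD0 lebesgue_vol0 add0e. Qed.

End SimplexImages.

(** * Volume of the grid polytope as a sum of determinants *)

Section GridVolume.
Variables (R : realType) (n m N : nat) (b : bool) (e : nat -> nat).
Hypothesis n_mb : n.+1 = (2 * m + b)%N.
Hypothesis e_dec : forall j, (j < n)%N -> (e j.+1 < e j)%N.
Hypothesis e_gt0 : (0 < e n)%N.
Hypothesis N_gt0 : (0 < N)%N.
Local Notation T := (n.+1.-tuple R).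
Local Notation mu := (@lebesgue_vol R n.+1).
Local Notation node := (@node R N).
Local Notation node_mx := (@node_mx R n N e).
Local Notation grid_hull := (@grid_hull R n N e).
Local Notation grid_rep := (@grid_rep R n N e).
Local Notation paired := (@paired m N).

(** Converse to [grid_rep_simplex]: the slack of the simplex becomes the weight of node 0. *)
Lemma simplex_grid_rep (c : nat -> nat) (x : T) : (forall k : 'I_n.+1, (c k <= N)%N) ->
  (lin (node_mx c) @` @simplex R n) x ->
  exists2 w, grid_rep x w &
    forall k : 'I_N.+1, (0 < k)%N -> 0 < w k -> exists q : 'I_n.+1, c q = k.
Proof.
move=> cN [y [y0 y1] <-].
pose s (q : 'I_n.+1) : 'I_N.+1 := inord (c q).
have sE q : s q = c q :> nat by rewrite inordK// ltnS.
pose w (k : 'I_N.+1) := \sum_(q | s q == k) tnth y q + (k == ord0)%:R * (1 - \sum_q tnth y q).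
have ww (f : 'I_N.+1 -> R) : \sum_k w k * f k =
    \sum_q tnth y q * f (s q) + (1 - \sum_q tnth y q) * f ord0.
  under eq_bigr do rewrite mulrDl.
  rewrite big_split/=; congr (_ + _).
    rewrite [RHS](partition_big s xpredT)//=; apply: eq_bigr => k _.
    by rewrite mulr_suml; apply: eq_bigr => q /eqP ->.
  by rewrite (bigD1 ord0)//= mul1r [X in _ + X]big1 ?addr0// => k /negPf ->; rewrite !mul0r.
exists w.
  split=> [k||j].
  - by rewrite /w addr_ge0 ?sumr_ge0// mulr_ge0// subr_ge0.
  - have := ww (fun=> 1); under eq_bigr do rewrite mulr1.
    by move=> ->; under eq_bigr do rewrite mulr1; rewrite mulr1 addrC subrK.
  - rewrite ww node0 expr0n gtn_eqF ?mulr0 ?addr0; last first.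
      by apply: (e_pos e_dec e_gt0); rewrite -ltnS.
    by rewrite tnth_node_mx; apply: eq_bigr => q _; rewrite sE.
move=> k k0 wk; have [[q qk]|nq] := pselect (exists q, s q = k).
  by exists q; rewrite -qk sE.
move: wk; rewrite /w -val_eqE/= gtn_eqF// mul0r addr0 big1 ?ltxx// => q /eqP sq.
by case: nq; exists q.
Qed.

(** Passing through weights on the nodes makes the order and the multiplicity of columns
    irrelevant. *)
Lemma lin_simplex_sub (c c' : nat -> nat) : (forall k : 'I_n.+1, (c k <= N)%N) ->
  (forall k : 'I_n.+1, exists k' : 'I_n.+1, c k = c' k') ->
  lin (node_mx c) @` @simplex R n `<=` lin (node_mx c') @` @simplex R n.
Proof.
move=> cN cc' x /(simplex_grid_rep cN)[w xw wc].
apply: (grid_rep_simplex e_dec e_gt0 xw) => k k0 /(wc k k0)[q <-].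
by have [k' ->] := cc' q; exists k'.
Qed.

Lemma osimplex_grid_hull (c : nat -> nat) : (forall k : 'I_n.+1, (c k <= N)%N) ->
  lin (node_mx c) @` @osimplex R n `<=` grid_hull.
Proof.
move=> cN x [y yo yx]; have [|w xw _] := @simplex_grid_rep c x cN.
  by exists y => //; exact: osimplex_sub.
by exists w.
Qed.

Lemma grid_hull_vol_sets : (m <= N)%N ->
  mu grid_hull = ((\sum_(A : {set 'I_N} | #|A| == m)
    `|\det (node_mx (paired (set_index A)))|) / (n.+1)`!%:R)%:E.
Proof.
move=> mN; pose M (A : {set 'I_N}) := node_mx (paired (set_index A)).
have colN (A : {set 'I_N}) (k : 'I_n.+1) : (paired (set_index A) k <= N)%N.
  by apply: paired_le => t _; apply: set_index_lt.
apply/eqP; rewrite eq_le; apply/andP; split.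
  pose s := [seq A : {set 'I_N} <- index_enum _ | #|A| == m].
  apply: (@le_trans _ _ (\sum_(A <- s) mu (lin (M A) @` @simplex R n))%E).
    apply: le_trans (lebesgue_vol_bigU _ _); apply: le_lebesgue_vol => x.
    move=> /(grid_hull_cover n_mb e_dec e_gt0 N_gt0 mN)[A Am xA].
    by exists A => //; rewrite mem_filter Am eqxx mem_index_enum.
  rewrite big_filter mulr_suml -sumEFin; apply: lee_sum => A _.
  by rewrite vol_lin_simplex.
(* A singular matrix, as for a set with two adjacent elements, adds 0 to the sum; its image is
   replaced by the empty set, since splitting is available for invertible maps only. *)
pose F A := if M A \in unitmx then lin (M A) @` @osimplex R n else set0.
have sF A : splits (F A).
  rewrite /F; case: ifP => uM; [exact: splits_lin_osimplex|exact: splits_set0].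
pose s := [seq A : {set 'I_N} <- index_enum _ | (#|A| == m) && (M A \in unitmx)].
have := @splits_disjoint R n _ s F (filter_uniq _ (index_enum_uniq _)) sF.
have dF A B x : A \in s -> B \in s -> F A x -> F B x -> A = B.
  rewrite !mem_filter /F => /andP[/andP[/eqP Am uA] _] /andP[/andP[/eqP Bm uB] _].
  rewrite uA uB; apply: (open_simplices_disjoint n_mb e_dec e_gt0 N_gt0) => //.
    by rewrite -unitfE -unitmxE.
  by rewrite -unitfE -unitmxE.
move=> /(_ dF) /le_trans le; apply: le_trans (le _ _); last first.
  apply: le_lebesgue_vol => x [A _]; rewrite /F; case: ifP => // _.
  exact: osimplex_grid_hull.
rewrite big_filter mulr_suml -sumEFin (bigID (fun A => M A \in unitmx))/=.
rewrite [X in (_ + X)%E]big1 ?adde0 => [|A /andP[_]]; last first.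
  by rewrite unitmxE unitfE negbK => /eqP; rewrite /M => ->; rewrite normr0 mul0r.
by apply: lee_sum => A /andP[_ uA]; rewrite /F uA vol_lin_osimplex.
Qed.

Definition ffun_index (f : {ffun 'I_m -> 'I_N}) (t : nat) : nat :=
  if insub t is Some t' then val (f t') else 0%N.

Lemma ffun_indexE f (t : 'I_m) : ffun_index f t = f t.
Proof. by rewrite /ffun_index valK. Qed.

Lemma ffun_index_lt f t : (ffun_index f t < N)%N.
Proof. by rewrite /ffun_index; case: insub => [t'|//]; exact: ltn_ord. Qed.

Lemma paired_image_sub (i j : nat -> nat) :
  (forall t, (t < m)%N -> exists2 u, (u < m)%N & i t = j u) ->
  forall k : 'I_n.+1, exists k' : 'I_n.+1, paired i k = paired j k'.
Proof.
move=> ij k; have [km|mk] := ltnP k (2 * m); last first.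
  exists k; have mkF : (k < 2 * m)%N = false by rewrite ltnNge mk.
  by rewrite /paired mkF.
have k2 : (k./2 < m)%N by rewrite ltn_half_double -mul2n.
have [u um ju] := ij _ k2.
have q_lt (o : bool) : (2 * u + o < n.+1)%N by rewrite n_mb; move: um; case: o; lia.
exists (Ordinal (q_lt (odd k))); rewrite {1}/paired km ju.
by case: (odd k) => /=; rewrite ?addn1 ?addn0 ?paired_odd ?paired_even.
Qed.

(** The matrices differ by a permutation of columns, which need not be exhibited: both span the same
    simplex, and its volume determines the absolute determinant. *)
Lemma det_ffun_index (f : {ffun 'I_m -> 'I_N}) (A : {set 'I_N}) :
  injective f -> [set f t | t : 'I_m]%SET = A ->
  `|\det (node_mx (paired (ffun_index f)))| = `|\det (node_mx (paired (set_index A)))|.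
Proof.
move=> fI fA; have Am : #|A| = m by rewrite -fA card_imset ?card_ord.
have N0 : (n.+1)`!%:R != 0 :> R by rewrite pnatr_eq0 -lt0n fact_gt0.
suff : mu (lin (node_mx (paired (ffun_index f))) @` @simplex R n) =
       mu (lin (node_mx (paired (set_index A))) @` @simplex R n).
  by rewrite !vol_lin_simplex => -[] /(mulIf (invr_neq0 N0)).
congr (mu _); apply/seteqP; split; apply: lin_simplex_sub.
- by move=> k; apply: paired_le => t _; exact: ffun_index_lt.
- apply: paired_image_sub => t tm; rewrite -[t]/(val (Ordinal tm)) ffun_indexE.
  have : f (Ordinal tm) \in A by rewrite -fA; apply: imset_f.
  by case/set_index_mem => u; rewrite Am => um <-; exists u.
- by move=> k; apply: paired_le => t _; exact: set_index_lt.
- apply: paired_image_sub => t tm; have [k kA ->] := set_index_in N_gt0 Am tm.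
  move: kA; rewrite -fA => /imsetP[u _ ->]; exists u => //.
  by rewrite ffun_indexE.
Qed.

(** A Riemann sum over the cube runs over functions, not sets. Each [m]-set is the image of [m!]
    injective functions, and a non-injective function repeats a column. *)
Lemma grid_hull_vol : (m <= N)%N ->
  mu grid_hull = ((\sum_(f : {ffun 'I_m -> 'I_N})
    `|\det (node_mx (paired (ffun_index f)))|) / ((n.+1)`! * m`!)%:R)%:E.
Proof.
move=> mN; rewrite grid_hull_vol_sets// natrM.
have m0 : m`!%:R != 0 :> R by rewrite pnatr_eq0 -lt0n fact_gt0.
have n0 : (n.+1)`!%:R != 0 :> R by rewrite pnatr_eq0 -lt0n fact_gt0.
set SA := \sum_(A | _) _; set SF := \sum_f _.
suff -> : SF = m`!%:R * SA by congr (_%:E); field; rewrite m0.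
apply/esym; rewrite /SA /SF.
rewrite [RHS](bigID (fun f : {ffun 'I_m -> 'I_N} => injectiveb f))/= [X in _ = _ + X]big1 ?addr0.
  rewrite [RHS](partition_big (fun f : {ffun 'I_m -> 'I_N} => [set f t | t : 'I_m]%SET)
    (fun A => #|A| == m))/=; last first.
    by move=> f /injectiveP fI; rewrite card_imset// card_ord.
  rewrite mulr_sumr; apply: eq_bigr => A /eqP Am.
  rewrite [RHS](eq_bigr (fun=> `|\det (node_mx (paired (set_index A)))|)); last first.
    by move=> f /andP[/injectiveP fI /eqP fA]; apply: det_ffun_index.
  rewrite sumr_const mulr_natl; congr (_ *+ _).
  rewrite -(ffactnn m) -{1}Am -[X in _ ^_ X](card_ord m) -card_inj_ffuns_on.
  apply: eq_card => f; rewrite [LHS]inE [RHS]unfold_in /= andbC; apply: andb_id2l => /injectiveP fI.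
  apply/ffun_onP/eqP => [fA|<- t]; last by apply: imset_f.
  apply/eqP; rewrite eqEcard Am card_imset// card_ord leqnn andbT.
  by apply/fintype.subsetP => _ /imsetP[t _ ->]; apply: fA.
move=> f /injectivePn[t [u tu ftu]]; apply/eqP; rewrite normr_eq0.
have lt (v : 'I_m) : (2 * v < n.+1)%N by rewrite n_mb; have := ltn_ord v; lia.
apply: contraNT tu => d0; have := @det_node_mx_inj R n N e (paired (ffun_index f)) (Ordinal (lt t)) (Ordinal (lt u)) d0.
rewrite /= !paired_even// !ffun_indexE ftu => /(_ erefl) /(congr1 val)/= /eqP.
by rewrite eqn_mul2l/=.
Qed.

End GridVolume.

(** * From the discretised hull to the hull of the curve *)

Section Sandwich.
Variables (R : realType) (n : nat) (e : nat -> nat).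
Hypothesis e_dec : forall j, (j < n)%N -> (e j.+1 < e j)%N.
Hypothesis e_gt0 : (0 < e n)%N.
Local Notation T := (n.+1.-tuple R).
Local Notation mu := (@lebesgue_vol R n.+1).
Local Notation grid_hull N := (@grid_hull R n N e).
Local Notation K := (conv_hull (curve (R := R) (fun i : 'I_n.+1 => e i))).

Lemma grid_hull_sub_conv N : (0 < N)%N -> grid_hull N `<=` K.
Proof.
move=> N0 x [w [w0 w1 wx]].
exists N.+1, w, (fun k => moment_pt (fun i : 'I_n.+1 => e i) (node R N k)).
split=> // [k|j]; last by rewrite -wx; apply: eq_bigr => k _; rewrite tnth_mktuple.
exists (node R N k) => //; rewrite /= in_itv/= node_ge0/= -(nodeN R N0) ler_node//.
by rewrite -ltnS.
Qed.

Lemma expr_lipschitz (p q : R) k : 0 <= p <= 1 -> 0 <= q <= 1 ->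
  `|p ^+ k - q ^+ k| <= k%:R * `|p - q|.
Proof.
move=> /andP[p0 p1] /andP[q0 q1]; elim: k => [|k IH]; first by rewrite !expr0 subrr normr0 mul0r.
rewrite !exprS (_ : _ - _ = p * (p ^+ k - q ^+ k) + (p - q) * q ^+ k); last by ring.
apply: le_trans (ler_normD _ _) _; rewrite !normrM -natr1 mulrDl mul1r; apply: lerD.
  by apply: le_trans IH; rewrite ler_piMl// ger0_norm.
by rewrite ler_piMr// normrX exprn_ile1// ger0_norm.
Qed.

(** Rounding the parameters down to nodes moves each power by at most its exponent over [N];
    averaging with the same weights preserves the bound. *)
Lemma conv_near_grid N x : (0 < N)%N -> K x ->
  exists2 y, grid_hull N y & forall j, `|tnth x j - tnth y j| <= (e 0%N)%:R / N%:R.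
Proof.
move=> N0 [k [w [pt [w0 w1 ptK xw]]]].
have /choice[s sP] (i : 'I_k) : exists s : 'I_N.+1,
    forall j : 'I_n.+1, `|tnth (pt i) j - node R N s ^+ e j| <= (e 0%N)%:R / N%:R.
  have [p] := ptK i; rewrite /= in_itv/= => /andP[p0 p1] pti.
  have [|t tN /andP[tp pt1]] := @subdivision_cell R (node R N) N.-1 p.
    by rewrite prednK// node0 nodeN// p0.
  rewrite prednK// in tN.
  exists (Ordinal (ltnW tN : (t < N.+1)%N)) => j; rewrite -pti tnth_mktuple /=.
  have t01 : 0 <= node R N t <= 1 by rewrite node_ge0 (le_trans tp p1).
  apply: le_trans (expr_lipschitz _ _ t01) _; first by rewrite p0.
  apply: ler_pM => //.
    rewrite ler_nat; have [-> //|j0] := eqVneq (val j) 0%N.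
    by apply/ltnW/(decreasing_upto e_dec); [rewrite lt0n|rewrite -ltnS ltn_ord].
  rewrite ger0_norm ?subr_ge0//; move: pt1; rewrite /node -natr1 mulrDl mul1r; lra.
pose w' (l : 'I_N.+1) := \sum_(i | s i == l) w i.
have ww (f : 'I_N.+1 -> R) : \sum_l w' l * f l = \sum_i w i * f (s i).
  rewrite [RHS](partition_big s xpredT)//=; apply: eq_bigr => l _.
  by rewrite mulr_suml; apply: eq_bigr => i /eqP ->.
exists [tuple \sum_l w' l * node R N l ^+ e j | j < n.+1].
  exists w'; split=> [l||j]; first by rewrite sumr_ge0.
    by have := ww (fun=> 1); rewrite -!mulr_suml !mulr1 w1.
  by rewrite tnth_mktuple.
move=> j; rewrite tnth_mktuple ww xw -sumrB.
under eq_bigr do rewrite -mulrBr.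
apply: le_trans (ler_norm_sum _ _ _) _.
rewrite -[leRHS]mul1r -[X in _ <= X * _]w1 mulr_suml; apply: ler_sum => i _.
by rewrite normrM ger0_norm// ler_wpM2l//; exact: sP.
Qed.

Lemma grid_hull_convex N x y (t : R) : 0 <= t <= 1 -> grid_hull N x -> grid_hull N y ->
  grid_hull N [tuple t * tnth x j + (1 - t) * tnth y j | j < n.+1].
Proof.
move=> /andP[t0 t1] [w [w0 w1 wx]] [v [v0 v1 vy]].
exists (fun k => t * w k + (1 - t) * v k); split=> [k||j].
- by rewrite addr_ge0// mulr_ge0// subr_ge0.
- by rewrite big_split/= -!mulr_sumr w1 v1; ring.
- rewrite tnth_mktuple -wx -vy !mulr_sumr -big_split; apply: eq_bigr => k _ /=; ring.
Qed.

(** The simplex on 0 and the multiples of [n.+1^-1] up to 1 is nondegenerate, and all its vertices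
    are grid points when [N] is a multiple of [n.+1]. This is why only such [N] are used. *)
Lemma grid_hull_ball : exists q : T, exists2 r : R, 0 < r &
  forall k x, (forall j, `|tnth x j - tnth q j| <= r) -> grid_hull (n.+1 * k.+1) x.
Proof.
pose c k := k.+1; pose L := node_mx R n n.+1 e c.
have uL : L \in unitmx.
  rewrite unitmxE unitfE -det_tr.
  have [|i iN|s s0] := @gen_vandermonde_gt0 R n.+1 e (fun k => node R n.+1 (c k)).
  - by move=> j; rewrite ltnS; exact: e_dec.
  - by left; rewrite -(node0 R n.+1) ltr_node.
  rewrite (_ : \matrix_(i, j) _ = L^T); last by apply/matrixP => i j; rewrite !mxE.
  move=> ->; apply: mulf_neq0; first by rewrite gt_eqF.
  apply/negP => /prodf_eq0[j _ /prodf_eq0[i _]].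
  rewrite subr_eq0 => /eqP/node_inj => /(_ isT)/succn_inj ij.
  by have := ltn_ord i; rewrite ij ltnn.
pose u : T := [tuple (2 * n.+1%:R)^-1 | j < n.+1].
(* [B] bounds the absolute row sums of the inverse. Within the chosen radius the preimage therefore
   has coordinates between 0 and [n.+1^-1], and they sum to at most 1. *)
pose B : R := 1 + \sum_j \sum_k `|invmx L j k|.
have B0 : 0 < B by rewrite ltr_pwDl// !sumr_ge0// => j _; rewrite sumr_ge0.
exists (lin L u), ((2 * n.+1%:R)^-1 / B) => [|k x xq].
  by rewrite divr_gt0// invr_gt0 mulr_gt0// ltr0n.
have cN (l : 'I_n.+1) : (l.+1 * k.+1 <= n.+1 * k.+1)%N by rewrite leq_mul2r ltn_ord orbT.
have [|w xw _] := @simplex_grid_rep R n (n.+1 * k.+1) e e_dec e_gt0 (fun l => l.+1 * k.+1)%N x cN.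
  have -> : node_mx R n (n.+1 * k.+1) e (fun l => l.+1 * k.+1)%N = L.
    apply/matrixP => i j; rewrite !mxE /node /c; congr (_ ^+ _).
    by rewrite !natrM -mulf_div divff ?mulr1// pnatr_eq0.
  exists (lin (invmx L) x); last by rewrite -lin_mul mulmxV// lin1.
  have yE j : `|tnth (lin (invmx L) x) j - (2 * n.+1%:R)^-1| <= (2 * n.+1%:R)^-1.
    have {1}-> : (2 * n.+1%:R)^-1 = tnth (lin (invmx L) (lin L u)) j.
      by rewrite -lin_mul mulVmx// lin1 tnth_mktuple.
    rewrite [tnth (lin _ x) _]tnth_mktuple [tnth (lin _ (lin _ _)) _]tnth_mktuple -sumrB.
    under eq_bigr do rewrite -mulrBr.
    apply: le_trans (ler_norm_sum _ _ _) _.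
    apply: (@le_trans _ _ (\sum_l `|invmx L j l| * ((2 * n.+1%:R)^-1 / B))).
      by apply: ler_sum => l _; rewrite normrM ler_wpM2l.
    rewrite -mulr_suml mulrCA ler_piMr ?invr_ge0 ?mulr_ge0// ler_pdivrMr// mul1r.
    rewrite /B [X in 1 + X](bigD1 j)//= addrCA lerDl addr_ge0// sumr_ge0// => i _.
    by rewrite sumr_ge0.
  have b0 j : 0 <= tnth (lin (invmx L) x) j <= n.+1%:R^-1.
    have := yE j; rewrite ler_distl subrr => /andP[-> h]; apply: le_trans h _.
    by rewrite -mulr2n -[_ *+ 2]mulr_natl invfM mulrA divff// mul1r.
  split=> [j|]; first by case/andP: (b0 j).
  apply: (@le_trans _ _ (\sum_(j < n.+1) n.+1%:R^-1)).
    by apply: ler_sum => j _; case/andP: (b0 j).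
  by rewrite sumr_const card_ord -[_ *+ _]mulr_natl divff.
by exists w.
Qed.

(** A point [x] of the hull and a nearby grid point [y] satisfy [x = y + t (u - q)] with [u] in the
    ball about [q]. So [x + t q] is [1 + t] times a convex combination of [y] and [u]. *)
Lemma conv_sub_dilated_grid N (q : T) (r : R) : (0 < N)%N -> 0 < r ->
  (forall x, (forall j, `|tnth x j - tnth q j| <= r) -> grid_hull N x) ->
  (mu K <= ((1 + (e 0%N)%:R / N%:R / r) ^+ n.+1)%:E * mu (grid_hull N))%E.
Proof.
move=> N0 r0 qr; set d := _ / N%:R; set t := d / r.
have e00 : (0 < e 0)%N by apply: (e_pos e_dec e_gt0).
have d0 : 0 < d by rewrite divr_gt0 ?ltr0n.
have t0 : 0 < t by rewrite divr_gt0.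
have t1 : 0 < 1 + t by rewrite addr_gt0.
have uM : (1 + t)%:M \in @unitmx R n.+1 by rewrite unitmxE det_scalar unitrX// unitfE gt_eqF.
have -> : ((1 + t) ^+ n.+1)%:E = (`|\det ((1 + t)%:M : 'M[R]_n.+1)|)%:E.
  by rewrite det_scalar ger0_norm// exprn_ge0// ltW.
rewrite -lin_vol// -[leRHS](translate_vol [tuple - t * tnth q j | j < n.+1]).
apply: le_lebesgue_vol => x Kx; have [y Gy xy] := conv_near_grid N0 Kx.
pose u : T := [tuple tnth q j + (tnth x j - tnth y j) / t | j < n.+1].
have Gu : grid_hull N u.
  apply: qr => j; rewrite tnth_mktuple addrC addKr normrM normfV (ger0_norm (ltW t0)).
  by rewrite ler_pdivrMr// /t mulrC divfK ?gt_eqF.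
have s01 : 0 <= (1 + t)^-1 <= 1 by rewrite invr_ge0 ltW//= invf_le1// lerDl ltW.
have := grid_hull_convex s01 Gy Gu; set v := mktuple _ => Gv.
exists (lin (1 + t)%:M v); first by exists v.
apply: eq_from_tnth => j; rewrite [LHS]tnth_mktuple.
have -> : tnth (lin (1 + t)%:M v) j = (1 + t) * tnth v j.
  rewrite tnth_mktuple (bigD1 j)//= mxE eqxx mulr1n big1 ?addr0// => k kj.
  by rewrite mxE eq_sym (negPf kj) mul0r.
rewrite !tnth_mktuple; field.
by rewrite !gt_eqF.
Qed.

Lemma conv_vol_limit (a : nat -> R) (l : R) :
  (forall k, mu (grid_hull (n.+1 * k.+1)) = (a k)%:E) -> a @ \oo --> l -> mu K = l%:E.
Proof.
move=> ga al; have [q [r r0 qr]] := grid_hull_ball.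
have le_aK k : ((a k)%:E <= mu K)%E.
  by rewrite -ga; apply: le_lebesgue_vol; exact: grid_hull_sub_conv.
pose t k : R := (e 0%N)%:R / (n.+1 * k.+1)%:R / r.
have le_Ka k : (mu K <= ((1 + t k) ^+ n.+1 * a k)%:E)%E.
  rewrite EFinM -ga; apply: (conv_sub_dilated_grid (q := q)) => // x; exact: qr.
have fK : mu K \is a fin_num.
  by rewrite ge0_fin_numE ?lebesgue_vol_ge0//; apply: le_lt_trans (le_Ka 0%N) (ltry _).
rewrite -(fineK fK); congr (_%:E); apply/eqP; rewrite eq_le; apply/andP; split.
  have cv : (fun k => (1 + t k) ^+ n.+1 * a k) @ \oo --> (1 + (e 0%N)%:R / n.+1%:R / r * 0) ^+ n.+1 * l.
    apply: cvgM => //.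
    apply: (cvg_comp (fun k => 1 + t k) (fun x : R => x ^+ n.+1)); last exact: exprn_continuous.
    apply: cvgD; first exact: cvg_cst.
    rewrite (_ : t = fun k => (e 0%N)%:R / n.+1%:R / r * k.+1%:R^-1).
      by apply: cvgM; [exact: cvg_cst|exact: cvg_harmonic].
    by apply/funext => k; rewrite /t natrM invfM; ring.
  rewrite mulr0 addr0 expr1n mul1r in cv.
  apply: cvgr_to_ge cv _; apply: nearW => k.
  by rewrite -lee_fin fineK.
apply: cvgr_to_le al _; apply: nearW => k.
by rewrite -lee_fin fineK.
Qed.

End Sandwich.

(** * Schur polynomials and Riemann sums *)

Section Schur.

(* Divide ['X^d] by the monic polynomial vanishing at all [x k]. *)
Lemma power_interpolation (S : idomainType) (N : nat) (x : 'I_N -> S) (d : nat) :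
  exists c : 'I_N -> S, forall i, x i ^+ d = \sum_(k < N) x i ^+ (N - k.+1) * c k.
Proof.
pose P : {poly S} := \prod_(k < N) ('X - (x k)%:P).
have mP : P \is monic by apply: monic_prod_XsubC.
have sP : size P = N.+1 by rewrite size_prod_XsubC /index_enum -enumT size_enum_ord.
exists (fun k : 'I_N => (Pdiv.Ring.rmodp 'X^d P)`_(N - k.+1)) => i.
have := Pdiv.RingMonic.rdivp_eq mP 'X^d => /(congr1 (fun p => p.[x i])).
have Pi : P.[x i] = 0 by rewrite /P horner_prod (bigD1 i)//= hornerXsubC subrr mul0r.
rewrite hornerXn hornerD hornerM Pi mulr0 add0r => ->.
rewrite (@horner_coef_wide _ N); last first.
  by rewrite -ltnS -sP Pdiv.Ring.ltn_rmodpN0// monic_neq0.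
rewrite (reindex_inj rev_ord_inj); apply: eq_bigr => k _ /=.
by rewrite mulrC.
Qed.

(** Writing each power in terms of the first [N] powers factors the alternant matrix through the
    Vandermonde matrix. This is the witness that the choice in [schur_mpoly] needs. *)
Lemma schur_existence (R : idomainType) (N : nat) (a : 'I_N -> nat) :
  exists s : {mpoly R[N]}, s * vandermonde_mpoly R N = alternant R a.
Proof.
have /choice[c cP] := fun j => power_interpolation (fun i : 'I_N => 'X_i : {mpoly R[N]}) (a j).
exists (\det (\matrix_(k < N, j < N) c j k)).
rewrite mulrC /vandermonde_mpoly /alternant -det_mulmx; congr (\det _).
apply/matrixP => i j; rewrite mxE [RHS]mxE cP; apply: eq_bigr => k _.
by rewrite [in LHS]mxE [X in _ * X]mxE.
Qed.

Lemma det_vdm (R : realFieldType) n (z : nat -> R) :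
  \det (\matrix_(i < n, j < n) z i ^+ (n - j.+1)) = vdm n z.
Proof.
elim: n => [|n IH]; first by rewrite det_mx00 /vdm big_ord0.
rewrite (@det_monomials_recr R n (fun j => n.+1 - j.+1)%N) => [|j jn]; last by lia.
rewrite subnn expr0 mul1r vdmS mulrC -IH; congr (\det _ * _).
apply/matrixP => i j; rewrite !mxE big_ord_recl/= big1 ?addr0 => [|k _].
  have jn := ltn_ord j.
  rewrite (_ : (0 < _)%N); last by lia.
  by rewrite expr0 !mul1r; congr (_ ^+ _); lia.
rewrite (_ : (_ < _)%N = false) ?mul0r//; apply/negbTE; rewrite -leqNgt /bump/=.
by move: (ltn_ord j); lia.
Qed.

Lemma schur_mpolyP (R : idomainType) N (lam : 'I_N -> nat) :
  schur_mpoly R lam * vandermonde_mpoly R N = alternant R (fun j => lam j + (N - j.+1))%N.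
Proof.
have H := @ClassicalEpsilon.epsilon_spec _ (inhabits (0 : {mpoly R[N]}))
  (fun s : {mpoly R[N]} => s * vandermonde_mpoly R N =
     alternant R (fun j => lam j + (N - j.+1))%N) (schur_existence _ _).
rewrite /schur_mpoly; exact H.
Qed.

Lemma schur_vdm (R : realFieldType) N (lam : 'I_N -> nat) (z : nat -> R) :
  schur lam (fun i => z i) * vdm N z =
  \det (\matrix_(i < N, j < N) z i ^+ (lam j + (N - j.+1))).
Proof.
have evalE (a : 'I_N -> nat) : (alternant R a).@[fun i => z i] = \det (\matrix_(i < N, j < N) z i ^+ a j).
  rewrite /alternant -(det_map_mx (meval (fun i : 'I_N => z i))); congr (\det _).
  by apply/matrixP => i j; rewrite !mxE rmorphXn/= mevalXU.
rewrite -det_vdm -(evalE (fun j => N - j.+1)%N) -(evalE (fun j => lam j + (N - j.+1))%N).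
by rewrite -schur_mpolyP mevalM.
Qed.

End Schur.

(** * Iterated integrals of polynomials over the cube *)

Section CubeIntegral.
Variable R : realType.

Lemma integral01_monomials (I : Type) (r : seq I) (c : I -> R) (a : I -> nat) :
  (\int[@lebesgue_measure R]_(x in `[0%R, 1%R]%classic) (\sum_(k <- r) c k * x ^+ a k)%:E =
   (\sum_(k <- r) c k / (a k).+1%:R)%:E)%E.
Proof.
pose p : {poly R} := \sum_(k <- r) c k *: 'X^(a k).
pose q : {poly R} := \sum_(k <- r) (c k / (a k).+1%:R) *: 'X^((a k).+1).
have qp : deriv q = p.
  rewrite /q linear_sum; apply: eq_bigr => k _.
  by rewrite /= derivZ derivXn/= -scalerMnr scalerMnl -[(_ / _) *+ _]mulr_natr divfK// pnatr_eq0.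
have pE x : p.[x] = \sum_(k <- r) c k * x ^+ a k.
  by rewrite horner_sum; apply: eq_bigr => k _; rewrite hornerZ hornerXn.
under eq_integral do rewrite -pE.
rewrite (@continuous_FTC2 R (horner p) (horner q))//.
- rewrite -EFinB /q !horner_sum -sumrB; congr (_%:E); apply: eq_bigr => k _.
  by rewrite !hornerZ !hornerXn expr1n expr0n/= mulr0 subr0 mulr1.
- exact/continuous_subspaceT/continuous_horner.
- split=> [x _||]; first exact: derivable_horner.
    by apply: cvg_at_right_filter; exact: continuous_horner.
  by apply: cvg_at_left_filter; exact: continuous_horner.
- by move=> x _; rewrite -derivE qp.
Qed.

(** Integrating out one variable returns a list of monomials of the same shape, so the iterated
    integral is computed directly. *)
Lemma cube_integral_monomials (I : Type) (r : seq I) m (c : I -> R) (a : I -> nat -> nat) :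
  cube_integral (fun x : m.-tuple R => \sum_(k <- r) c k * \prod_(t < m) nth 0 x t ^+ a k t) =
  (\sum_(k <- r) c k * \prod_(t < m) ((a k t).+1%:R)^-1)%:E.
Proof.
elim: m c a => [|m IH] c a /=.
  by congr (_%:E); apply: eq_bigr => k _; rewrite !big_ord0.
under eq_integral => x _.
  rewrite (_ : (fun t : m.-tuple R => _) = (fun t : m.-tuple R =>
      \sum_(k <- r) (c k * x ^+ a k 0%N) * \prod_(i < m) nth 0 t i ^+ a k i.+1)); last first.
    apply/funext => t; apply: eq_bigr => k _.
    by rewrite big_ord_recl/= mulrA.
  rewrite (IH (fun k => c k * x ^+ a k 0%N) (fun k i => a k i.+1)).
  rewrite (eq_bigr (fun k => (c k * \prod_(t < m) ((a k t.+1).+1%:R)^-1) * x ^+ a k 0%N)); last first.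
    by move=> k _; rewrite mulrAC.
  over.
rewrite (integral01_monomials r (fun k => c k * \prod_(t < m) ((a k t.+1).+1%:R)^-1) (fun k => a k 0%N)).
congr (_%:E); apply: eq_bigr => k _.
by rewrite big_ord_recl/= mulrAC mulrA.
Qed.

End CubeIntegral.

(** * Riemann sums over consecutive nodes *)

Section RiemannSums.
Variable R : realType.

Lemma power_increment_bounds (y : R) d : 0 <= y ->
  y ^+ d *+ d.+1 <= (y + 1) ^+ d.+1 - y ^+ d.+1 <= (y + 1) ^+ d *+ d.+1.
Proof.
move=> y0; have y1 : y <= y + 1 by rewrite lerDl.
have y10 : 0 <= y + 1 by rewrite addr_ge0.
rewrite subrXX (_ : y + 1 - y = 1) ?mul1r; last by rewrite addrC addKr.
have c (x : R) : x *+ d.+1 = \sum_(i < d.+1) x by rewrite sumr_const card_ord.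
rewrite !c; apply/andP; split; apply: ler_sum => i _ /=; have id := leq_ord i.
  by rewrite -{1}(subnK id) exprD ler_wpM2r ?exprn_ge0// lerXn2r// nnegrE.
by rewrite -[X in _ <= _ ^+ X](subnK id) exprD ler_wpM2l ?exprn_ge0// lerXn2r// nnegrE.
Qed.

Lemma power_sum_bounds N d :
  (\sum_(i < N) i%:R ^+ d) *+ d.+1 <= (N%:R : R) ^+ d.+1 <= (\sum_(i < N) i.+1%:R ^+ d) *+ d.+1.
Proof.
elim: N => [|N /andP[IH1 IH2]]; first by rewrite !big_ord0 mul0rn expr0n lexx.
have /andP[h1 h2] := @power_increment_bounds N%:R d (ler0n _ _).
rewrite natr1 in h1 h2.
by rewrite !big_ord_recr/= !mulrnDl; apply/andP; split; lra.
Qed.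

(** Both [S / N] and the integral of [x ^+ (a + b)] lie between the left and the right Riemann sum
    of that power, whose difference telescopes to at most [N^-1]. *)
Lemma riemann_sum_bound N a b : (0 < N)%N ->
  `|N%:R^-1 * (\sum_(i < N) node R N i ^+ a * node R N i.+1 ^+ b) - ((a + b).+1%:R)^-1| <= N%:R^-1.
Proof.
move=> N0; set d := (a + b)%N; set S := \sum_(i < N) _.
have Np : 0 < N%:R :> R by rewrite ltr0n.
pose lo : R := \sum_(i < N) node R N i ^+ d; pose hi : R := \sum_(i < N) node R N i.+1 ^+ d.
have loS : lo <= S.
  apply: ler_sum => i _; rewrite exprD ler_wpM2l ?exprn_ge0 ?node_ge0//.
  by rewrite lerXn2r ?nnegrE ?node_ge0 ?ler_node.
have Shi : S <= hi.
  apply: ler_sum => i _; rewrite [leRHS]exprD ler_wpM2r ?exprn_ge0 ?node_ge0//.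
  by rewrite lerXn2r ?nnegrE ?node_ge0 ?ler_node.
have hilo : hi - lo <= 1.
  rewrite /hi /lo -sumrB -(big_mkord xpredT (fun i => node R N i.+1 ^+ d - node R N i ^+ d)).
  by rewrite telescope_sumr// nodeN// expr1n lerBlDr lerDl exprn_ge0 ?node_ge0.
have scale (f : nat -> nat) : \sum_(i < N) node R N (f i) ^+ d = (\sum_(i < N) (f i)%:R ^+ d) / N%:R ^+ d.
  by rewrite mulr_suml; apply: eq_bigr => i _; rewrite /node expr_div_n.
have /andP[p1 p2] := power_sum_bounds N d.
have Nd : 0 < N%:R ^+ d :> R by rewrite exprn_gt0.
have d1 : 0 < d.+1%:R :> R by rewrite ltr0n.
have lo1 : N%:R^-1 * lo <= d.+1%:R^-1.
  rewrite /lo (scale id) mulrCA -invfM -exprS ler_pdivrMr ?exprn_gt0//.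
  by rewrite mulrC ler_pdivlMr// mulr_natr.
have hi1 : d.+1%:R^-1 <= N%:R^-1 * hi.
  rewrite /hi (scale succn) mulrCA -invfM -exprS ler_pdivlMr ?exprn_gt0//.
  by rewrite mulrC ler_pdivrMr// mulr_natr.
have Ni : 0 < N%:R^-1 :> R by rewrite invr_gt0.
have a1 := ler_wpM2l (ltW Ni) loS; have a2 := ler_wpM2l (ltW Ni) Shi.
have a3 := ler_wpM2l (ltW Ni) hilo; rewrite mulr1 mulrBr in a3.
rewrite ler_norml; move: a1 a2 a3 lo1 hi1.
move: (N%:R^-1 * lo) (N%:R^-1 * S) (N%:R^-1 * hi) (N%:R^-1) (d.+1%:R^-1) => x1 x2 x3 x4 x5.
by move=> *; apply/andP; split; lra.
Qed.

Lemma riemann_sum_cvg n a b :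
  (fun k => let N := (n.+1 * k.+1)%N in
     N%:R^-1 * (\sum_(i < N) node R N i ^+ a * node R N i.+1 ^+ b)) @ \oo --> (((a + b).+1%:R)^-1 : R).
Proof.
have h : (fun k : nat => (n.+1%:R)^-1 * k.+1%:R^-1 : R) @ \oo --> ((n.+1%:R)^-1 * 0 : R).
  by apply: cvgM; [exact: cvg_cst|exact: cvg_harmonic].
rewrite mulr0 in h.
apply: (@squeeze_cvgr _ _ _ _ (fun k : nat => ((a + b).+1%:R)^-1 - (n.+1%:R)^-1 * k.+1%:R^-1)
  (fun k : nat => ((a + b).+1%:R)^-1 + (n.+1%:R)^-1 * k.+1%:R^-1)).
- apply: nearW => k /=; have N0 : (0 < n.+1 * k.+1)%N by rewrite muln_gt0.
  by have := riemann_sum_bound a b N0; rewrite -invfM -natrM ler_distl.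
- by rewrite -[X in _ --> X]subr0; apply: cvgB => //; exact: cvg_cst.
- by rewrite -[X in _ --> X]addr0; apply: cvgD => //; exact: cvg_cst.
Qed.

(** For a monomial the sum over functions factors into one-dimensional sums. *)
Lemma riemann_cube_cvg (I : Type) (r : seq I) m n (c : I -> R) (a b : I -> nat -> nat) :
  (fun k => let N := (n.+1 * k.+1)%N in
     N%:R^-1 ^+ m * \sum_(f : {ffun 'I_m -> 'I_N}) \sum_(i <- r) c i *
       \prod_(t < m) (node R N (f t) ^+ a i t * node R N (f t).+1 ^+ b i t)) @ \oo -->
  \sum_(i <- r) c i * \prod_(t < m) (((a i t + b i t).+1%:R)^-1 : R).
Proof.
rewrite (_ : (fun k => _) = (fun k => \sum_(i <- r) c i * \prod_(t < m)
    ((n.+1 * k.+1)%:R^-1 * \sum_(l < n.+1 * k.+1) node R (n.+1 * k.+1) l ^+ a i t *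
       node R (n.+1 * k.+1) l.+1 ^+ b i t))).
  apply: cvg_big => [|i _]; first exact: add_continuous.
  apply: cvgM; first exact: cvg_cst.
  apply: cvg_big => [|t _]; first exact: mul_continuous.
  exact: riemann_sum_cvg.
apply/funext => k; set N := (n.+1 * k.+1)%N.
rewrite exchange_big mulr_sumr; apply: eq_bigr => i _ /=.
rewrite -mulr_sumr mulrCA; congr (_ * _).
rewrite big_split/= prodr_const card_ord; congr (_ * _).
by rewrite (bigA_distr_bigA (fun (t : 'I_m) (l : 'I_N) => node R N l ^+ a i t * node R N l.+1 ^+ b i t)).
Qed.

End RiemannSums.

(** * Vandermonde factors across distinct pairs *)

Section PairVandermonde.
Variable R : realType.

(** What remains of [vdm (2 * m + b)] without the difference inside each pair, the factor that
    vanishes when the two arguments of the pair coincide. *)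
Definition pair_vdm (b : bool) (m : nat) (z : nat -> R) : R :=
  (\prod_(j < m) \prod_(i < j)
     ((z (2 * i)%N - z (2 * j)%N) * (z (2 * i)%N - z (2 * j).+1) *
      ((z (2 * i).+1 - z (2 * j)%N) * (z (2 * i).+1 - z (2 * j).+1)))) *
  (if b then \prod_(i < m) ((z (2 * i)%N - z (2 * m)%N) * (z (2 * i).+1 - z (2 * m)%N)) else 1).

Lemma vdm_pairs (b : bool) m (z : nat -> R) :
  vdm (2 * m + b) z = pair_vdm b m z * \prod_(i < m) (z (2 * i)%N - z (2 * i).+1).
Proof.
rewrite /pair_vdm; set Q := (X in X * _ * _); set P := \prod_(i < m) (z (2 * i)%N - _).
have QP : vdm (2 * m) z = Q * P.
  rewrite /Q /P; elim: m {Q P} => [|m IH]; first by rewrite muln0 /vdm !big_ord0 mulr1.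
  rewrite mulnS !vdmS IH !big_ord_recr/= !big_split/=.
  rewrite (prod_pairs m (fun i => z i - z (2 * m)%N)) (prod_pairs m (fun i => z i - z (2 * m).+1)).
  rewrite !big_split/=; ring.
case: b; last by rewrite addn0 mulr1.
by rewrite addn1 vdmS QP (prod_pairs m (fun i => z i - z (2 * m)%N)); ring.
Qed.

Definition doubled m (x : m.-tuple R) (k : nat) : R :=
  if (k < 2 * m)%N then nth 0 x k./2 else 1.

Lemma doubled_even m (x : m.-tuple R) i : (i < m)%N -> doubled x (2 * i)%N = nth 0 x i.
Proof. by move=> im; rewrite /doubled ltn_mul2l im/= mul2n doubleK. Qed.

Lemma doubled_odd m (x : m.-tuple R) i : (i < m)%N -> doubled x (2 * i).+1 = nth 0 x i.
Proof.
move=> im; rewrite /doubled (_ : (_ < _)%N); last by rewrite !mul2n -ltn_half_double /= uphalf_double.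
by rewrite mul2n /= uphalf_double.
Qed.

Lemma doubled_last m (x : m.-tuple R) : doubled x (2 * m)%N = 1.
Proof. by rewrite /doubled ltnn. Qed.

Lemma pair_vdm_doubled b m (x : m.-tuple R) : pair_vdm b m (doubled x) =
  (\prod_(i < m) \prod_(j < m | (i < j)%N) (tnth x i - tnth x j) ^+ 4) *
  (if b then \prod_(i < m) (1 - tnth x i) ^+ 2 else 1).
Proof.
rewrite /pair_vdm; congr (_ * _).
  rewrite [RHS](exchange_big_dep xpredT)//=; apply: eq_bigr => j _.
  rewrite (big_ord_narrow (ltnW (ltn_ord j))); apply: eq_bigr => i _.
  have im : (i < m)%N by apply: ltn_trans (ltn_ord i) (ltn_ord j).
  by rewrite !doubled_even ?doubled_odd// !(tnth_nth 0)/=; ring.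
case: b => //; apply: eq_bigr => i _.
by rewrite doubled_even ?doubled_odd ?doubled_last// (tnth_nth 0); ring.
Qed.

End PairVandermonde.

(** * Expansion of the integrand into monomials *)

Section PolynomialFunctions.
Variables (R : realType) (n : nat).

Definition polynomial_fun (g : (nat -> R) -> R) :=
  exists p : {mpoly R[n.+1]}, forall z : nat -> R, p.@[fun i => z i] = g z.

Lemma polynomial_fun_var k : (k <= n)%N -> polynomial_fun (fun z => z k).
Proof. by move=> kn; exists 'X_(inord k) => z; rewrite mevalXU inordK. Qed.

Lemma polynomial_fun_const c : polynomial_fun (fun=> c).
Proof. by exists c%:MP => z; rewrite mevalC. Qed.

Lemma polynomial_fun_sub f g : polynomial_fun f -> polynomial_fun g ->
  polynomial_fun (fun z => f z - g z).
Proof. by move=> [p pf] [q qg]; exists (p - q) => z; rewrite mevalB pf qg. Qed.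

Lemma polynomial_fun_mul f g : polynomial_fun f -> polynomial_fun g ->
  polynomial_fun (fun z => f z * g z).
Proof. by move=> [p pf] [q qg]; exists (p * q) => z; rewrite mevalM pf qg. Qed.

Lemma polynomial_fun_prod (m : nat) (f : nat -> (nat -> R) -> R) :
  (forall i, (i < m)%N -> polynomial_fun (f i)) ->
  polynomial_fun (fun z => \prod_(i < m) f i z).
Proof.
elim: m => [|m IH] fP.
  by have [p pP] := polynomial_fun_const 1; exists p => z; rewrite pP big_ord0.
have [p pP] : polynomial_fun (fun z => \prod_(i < m) f i z).
  by apply: IH => i im; apply: fP; exact: ltnW.
have [q qP] := fP m (ltnSn m).
by exists (p * q) => z; rewrite mevalM pP qP big_ord_recr.
Qed.

Lemma polynomial_fun_schur_pair (b : bool) m (lam : 'I_n.+1 -> nat) : n.+1 = (2 * m + b)%N ->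
  polynomial_fun (fun z => schur lam (fun i => z i) * pair_vdm b m z).
Proof.
move=> n_mb; apply: polynomial_fun_mul; first by exists (schur_mpoly R lam).
have ev i : (i < m)%N -> polynomial_fun (fun z => z (2 * i)%N).
  by move=> im; apply: polynomial_fun_var; rewrite -ltnS n_mb; move: im; lia.
have od i : (i < m)%N -> polynomial_fun (fun z => z (2 * i).+1).
  by move=> im; apply: polynomial_fun_var; rewrite -ltnS n_mb; move: im; lia.
apply: polynomial_fun_mul.
  pose g i j (z : nat -> R) := (z (2 * i)%N - z (2 * j)%N) * (z (2 * i)%N - z (2 * j).+1) *
      ((z (2 * i).+1 - z (2 * j)%N) * (z (2 * i).+1 - z (2 * j).+1)).
  apply: (@polynomial_fun_prod m (fun j z => \prod_(i < j) g i j z)) => j jm.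
  apply: (@polynomial_fun_prod j (fun i z => g i j z)) => i ij.
  have im := ltn_trans ij jm.
  apply: polynomial_fun_mul; apply: polynomial_fun_mul; apply: polynomial_fun_sub;
    solve [exact: ev | exact: od].
case: b n_mb => n_mb; last exact: polynomial_fun_const.
apply: (@polynomial_fun_prod m
  (fun i z => (z (2 * i)%N - z (2 * m)%N) * (z (2 * i).+1 - z (2 * m)%N))) => i im.
have la : polynomial_fun (fun z => z (2 * m)%N).
  by apply: polynomial_fun_var; rewrite -ltnS n_mb addn1.
by apply: polynomial_fun_mul; apply: polynomial_fun_sub => //; [exact: ev|exact: od].
Qed.

(** In odd dimension the last variable is 1 and drops out, so the remaining ones group into
    pairs. *)
Lemma polynomial_fun_monomials (b : bool) m g : n.+1 = (2 * m + b)%N -> polynomial_fun g ->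
  exists (I : Type) (r : seq I) (c : I -> R) (a a' : I -> nat -> nat),
  forall z : nat -> R, z (2 * m)%N = 1 ->
    g z = \sum_(i <- r) c i * \prod_(t < m) (z (2 * t)%N ^+ a i t * z (2 * t).+1 ^+ a' i t).
Proof.
move=> n_mb [p pg]; exists 'X_{1..n.+1}, (msupp p), (fun i => p@_i),
  (fun i t => i (inord (2 * t))), (fun i t => i (inord (2 * t).+1)) => z zm.
rewrite -pg mevalE; apply: eq_bigr => i _; congr (_ * _).
pose F k := z k ^+ i (inord k).
rewrite (eq_bigr (fun k : 'I_n.+1 => F k)); last by move=> k _; rewrite /F inord_val.
have -> : \prod_(k < n.+1) F k = \prod_(k < 2 * m + b) F k by rewrite -n_mb.
case: b {n_mb} => /=; last by rewrite addn0 prod_pairs.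
have Fm : F (2 * m)%N = 1 by rewrite /F zm expr1n.
by rewrite addn1 big_ord_recr/= prod_pairs Fm mulr1.
Qed.

End PolynomialFunctions.

(** * Volume of the hull as an integral *)

Section HullVolume.
Variables (R : realType) (n m : nat) (b : bool) (e : nat -> nat) (lam : 'I_n.+1 -> nat).
Hypothesis n_mb : n.+1 = (2 * m + b)%N.
Hypothesis e_dec : forall j, (j < n)%N -> (e j.+1 < e j)%N.
Hypothesis e_gt0 : (0 < e n)%N.
Hypothesis lamE : forall j : 'I_n.+1, (lam j + (n.+1 - j.+1))%N = e j.

(** The differences inside the pairs are all [- N^-1], which yields the mesh factor [N^-1 ^+ m]; the
    absolute value disappears because the other factor is nonnegative. *)
Lemma abs_det_pairs N (f : {ffun 'I_m -> 'I_N}) : (0 < N)%N ->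
  let z k := node R N (paired m N (ffun_index f) k) in
  `|\det (node_mx R n N e (paired m N (ffun_index f)))| =
  N%:R^-1 ^+ m * (schur lam (fun i => z i) * pair_vdm b m z).
Proof.
move=> N0 z; set D := \det _.
have z_even (t : 'I_m) : z (2 * t)%N = node R N (f t) by rewrite /z paired_even// ffun_indexE.
have z_odd (t : 'I_m) : z (2 * t).+1 = node R N (f t).+1 by rewrite /z paired_odd// ffun_indexE.
have z_last : z (2 * m)%N = 1 by rewrite /z /paired ltnn nodeN.
have DE : D = \det (\matrix_(i < n.+1, j < n.+1) z i ^+ e j).
  by rewrite -[RHS]det_tr; congr (\det _); apply/matrixP => i j; rewrite !mxE.
have DS : D = schur lam (fun i => z i) * vdm n.+1 z.
  rewrite schur_vdm DE; congr (\det _); apply/matrixP => i j; rewrite !mxE.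
  by rewrite lamE.
have vW : vdm n.+1 z = pair_vdm b m z * (- N%:R^-1) ^+ m.
  have -> : vdm n.+1 z = vdm (2 * m + b) z by rewrite -n_mb.
  rewrite vdm_pairs; congr (_ * _).
  rewrite (eq_bigr (fun=> - N%:R^-1)) ?prodr_const ?card_ord// => i _.
  by rewrite z_even z_odd /node -natr1 mulrDl mul1r opprD addrA subrr add0r.
have W0 : 0 <= pair_vdm b m z.
  rewrite /pair_vdm mulr_ge0//.
    apply: prodr_ge0 => j _; apply: prodr_ge0 => i _.
    have im : (i < m)%N by apply: ltn_trans (ltn_ord i) (ltn_ord j).
    have := z_even (Ordinal im); have := z_odd (Ordinal im) => /= -> ->.
    rewrite z_even z_odd; move: (nat_of_ord (f _)) (nat_of_ord (f _)) => l k.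
    have [kl|lk|kl] := ssrnat.ltngtP k l.
    - by apply: mulr_ge0; apply: mulr_le0; rewrite subr_le0 ler_node//; move: kl; clear; lia.
    - by apply: mulr_ge0; apply: mulr_ge0; rewrite subr_ge0 ler_node//; move: lk; clear; lia.
    - by rewrite kl subrr !(mul0r, mulr0).
  case: b => //; apply: prodr_ge0 => i _; rewrite z_even z_odd z_last -(nodeN R N0).
  by rewrite mulr_le0// subr_le0 ler_node// ltnW.
(* If [D] is 0 so is this product, which differs from [D] by a power of [- N^-1]. Otherwise all
   nodes are positive and the Schur value is the positive quotient of [gen_vandermonde_gt0]. *)
have sW : 0 <= schur lam (fun i => z i) * pair_vdm b m z.
  have [D0|D0] := eqVneq D 0.
    move: D0; rewrite DS vW mulrA => /eqP; rewrite mulf_eq0 expf_eq0 oppr_eq0 invr_eq0.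
    by rewrite pnatr_eq0 gtn_eqF//= andbF orbF => /eqP ->.
  have [|i iN|s s0 Ds] := @gen_vandermonde_gt0 R n.+1 e z.
  - by move=> j; rewrite ltnS; exact: e_dec.
  - left; rewrite -(node0 R N) ltr_node//.
    exact: (det_node_mx_gt0 e_dec e_gt0 (Ordinal iN) D0).
  have v0 : vdm n.+1 z != 0 by apply: contraNneq D0; rewrite DS => ->; rewrite mulr0.
  have -> : schur lam (fun i => z i) = s by apply: (mulIf v0); rewrite -DS DE.
  by rewrite mulr_ge0// ltW.
rewrite DS vW mulrA normrM normrX normrN ger0_norm// ger0_norm ?invr_ge0//.
by rewrite mulrC.
Qed.

(** A single list of monomials serves both sides: at consecutive nodes it gives the Riemann sums,
    and at doubled arguments, where the two exponents of a pair add up, the integrand. *)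
Lemma hull_volume :
  lebesgue_vol (conv_hull (curve (R := R) (fun i : 'I_n.+1 => e i))) =
  (((((n.+1)`! * m`!)%:R)^-1 : R)%:E *
  cube_integral (fun x : m.-tuple R =>
    (schur lam (fun k => doubled x k) * pair_vdm b m (doubled x))%R))%E.
Proof.
have [I [r [c [a [a' gE]]]]] := polynomial_fun_monomials n_mb
  (polynomial_fun_schur_pair R lam n_mb).
rewrite (_ : (fun x : m.-tuple R => _) = (fun x : m.-tuple R =>
    \sum_(i <- r) c i * \prod_(t < m) nth 0 x t ^+ (a i t + a' i t))); last first.
  apply/funext => x; rewrite gE ?doubled_last//; apply: eq_bigr => i _; congr (_ * _).
  by apply: eq_bigr => t _; rewrite doubled_even// doubled_odd// exprD.
rewrite (cube_integral_monomials r m c (fun i t => a i t + a' i t)%N) -EFinM.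
have m_le_n : (m <= n.+1)%N by rewrite n_mb; lia.
apply: (conv_vol_limit e_dec e_gt0 (a := fun k => (((n.+1)`! * m`!)%:R)^-1 *
  ((n.+1 * k.+1)%:R^-1 ^+ m * \sum_(f : {ffun 'I_m -> 'I_(n.+1 * k.+1)}) \sum_(i <- r) c i *
       \prod_(t < m) (node R (n.+1 * k.+1) (f t) ^+ a i t *
                      node R (n.+1 * k.+1) (f t).+1 ^+ a' i t)))).
  move=> k; set N := (n.+1 * k.+1)%N; have N0 : (0 < N)%N by [].
  rewrite (grid_hull_vol R n_mb e_dec e_gt0 N0); last by rewrite (leq_trans m_le_n)// leq_pmulr.
  congr (_%:E); rewrite mulrC; congr (_ * _); rewrite mulr_sumr; apply: eq_bigr => f _.
  rewrite abs_det_pairs// gE; last by rewrite /paired ltnn nodeN.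
  congr (_ * _); apply: eq_bigr => i _; congr (_ * _); apply: eq_bigr => t _.
  by rewrite paired_even// paired_odd// ffun_indexE.
by apply: cvgM; [exact: cvg_cst|exact: riemann_cube_cvg].
Qed.

End HullVolume.

Lemma hull_volume_ord (R : realType) (d m : nat) (b : bool) (e : 'I_d -> nat) :
  (0 < d)%N -> d = (2 * m + b)%N ->
  (forall i j : 'I_d, (i < j)%N -> (e j < e i)%N) -> (forall i, (0 < e i)%N) ->
  lebesgue_vol (conv_hull (curve (R := R) e)) =
  ((((d`! * m`!)%:R)^-1 : R)%:E *
  cube_integral (fun x : m.-tuple R =>
    (schur (fun i : 'I_d => (e i + i.+1 - d)%N) (fun k => doubled x k) *
     pair_vdm b m (doubled x))%R))%E.
Proof.
case: d e => // n e _ n_mb e_dec e_gt0.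
pose e' k := e (inord k).
have e'E : (fun i : 'I_n.+1 => e' i) = e by apply/funext => i; rewrite /e' inord_val.
have e'_dec j : (j < n)%N -> (e' j.+1 < e' j)%N.
  by move=> jn; apply: e_dec; rewrite !inordK// ltnS ltnW.
(* Strictly decreasing positive exponents are large enough for the truncated subtraction in the
   partition to be exact. *)
have e'_ge k : (k <= n)%N -> (k < e' (n - k))%N.
  elim: k => [|k IH] kn; first by rewrite subn0; exact: e_gt0.
  have := e'_dec (n - k.+1)%N; rewrite -subSn// subSS; have := IH (ltnW kn).
  by move: kn; lia.
rewrite -{1}e'E; apply: hull_volume => // [|j]; first exact: e_gt0.
have := e'_ge (n - j)%N (leq_subr _ _); rewrite subKn ?leq_ord// /e' inord_val.
by move: (ltn_ord j); lia.
Qed.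

Local Close Scope classical_set_scope.

Theorem theorem3p4 (R : realType) (m : nat) : (1 < m)%N ->
  (* even case: n = 2m *)
  (forall F : 'I_(2 * m) -> simple_graph,
     injective F ->
     (forall i j : 'I_(2 * m), (i < j)%N -> (nedges (F j) < nedges (F i))%N) ->
     (forall i, (0 < nedges (F i))%N) ->
     let e := fun i => nedges (F i) in
     let lam := fun i : 'I_(2 * m) => (e i + i.+1 - 2 * m)%N in
     lebesgue_vol (conv_hull (curve (R:=R) e)) =
       ((((2 * m)`! * m`!)%:R)^-1 : R)%:E *
       cube_integral (fun x : m.-tuple R => (
         schur lam (fun k : 'I_(2 * m) => nth 0%R x k./2) *
         \prod_(i < m) \prod_(j < m | (i < j)%N) (tnth x i - tnth x j) ^+ 4)%R))%E
  /\
  (* odd case: n = 2m+1 *)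
  (forall F : 'I_(2 * m).+1 -> simple_graph,
     injective F ->
     (forall i j : 'I_(2 * m).+1, (i < j)%N -> (nedges (F j) < nedges (F i))%N) ->
     (forall i, (0 < nedges (F i))%N) ->
     let e := fun i => nedges (F i) in
     let lam := fun i : 'I_(2 * m).+1 => (e i + i.+1 - (2 * m).+1)%N in
     lebesgue_vol (conv_hull (curve (R:=R) e)) =
       (((((2 * m).+1)`! * m`!)%:R)^-1 : R)%:E *
       cube_integral (fun x : m.-tuple R => (
         schur lam (fun k : 'I_(2 * m).+1 =>
                      if (k < 2 * m)%N then nth 0%R x k./2 else 1) *
         \prod_(i < m) \prod_(j < m | (i < j)%N) (tnth x i - tnth x j) ^+ 4 *
         \prod_(i < m) (1 - tnth x i) ^+ 2)%R))%E.
Proof.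
move=> m_gt1; split=> F _ F_dec F_gt0 e lam.
  rewrite (@hull_volume_ord R (2 * m) m false e) ?addn0 ?muln_gt0 ?(ltnW m_gt1)//.
  congr (_ * cube_integral _)%E; apply/funext => x.
  rewrite pair_vdm_doubled mulr1; congr (schur _ _ * _); apply/funext => k.
  by rewrite /doubled ltn_ord.
rewrite (@hull_volume_ord R (2 * m).+1 m true e) ?addn1//.
congr (_ * cube_integral _)%E; apply/funext => x.
by rewrite pair_vdm_doubled mulrA.
Qed.
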